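(* Let $D$ be a symmetric convex body in $\mathbb{R}^n$ and $\delta\in(0,1)$. For any $\tau>0$, any $n$-tuple of vectors $x_1,\ldots,x_n\in\mathbb{R}^n$ with $$\min_{\epsilon_i=\pm1}\left\|\sum_{i=1}^n\epsilon_i x_i\right\|_2\ge\tau\sqrt n,$$ and any $S\subseteq\{-1,1\}^n$ with $|S|\le 2^{\delta n}$, there is some $\mathcal{U}\subseteq O(n)$ with $\nu_n(\mathcal{U})\ge 1-e^{-n}$ such that for every $U\in\mathcal{U}$, $$\left\|\sum_{i=1}^n\epsilon_i U(x_i)\right\|_D\ge\tau\, t_{D,\delta}\, m(D)$$ holds for all $\epsilon=(\epsilon_1,\ldots,\epsilon_n)\in S$.
   Context: A symmetric convex body $D$ in $\mathbb{R}^n$ is a compact convex set with nonempty interior and $D=-D$; $\|x\|_D=\inf\{r>0: x\in rD\}$ is the norm with unit ball $D$. $\|\cdot\|_2$ is the Euclidean norm, $|S|$ is the cardinality of $S$, $O(n)$ is the orthogonal group and $\nu_n$ its Haar probability measure. $\gamma_n$ is the standard Gaussian measure on $\mathbb{R}^n$, and $m(D)$ is the median of $\|\cdot\|_D$ with respect to $\gamma_n$. For $\delta\in(0,1)$, $$t_{D,\delta}:=\max\{t>0:\gamma_n(2t\, m(D)\,D)\le(2^{\delta}e)^{-n}\}.$$ *)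

(* Defs.v *)
From HB Require Import structures.
From mathcomp Require Import all_boot all_order all_algebra.
From mathcomp Require Import all_classical all_reals all_analysis.
From mathcomp Require Import measurable_realfun.

Set Implicit Arguments.
Unset Strict Implicit.
Unset Printing Implicit Defensive.

Import Order.TTheory GRing.Theory Num.Theory.
Import numFieldNormedType.Exports.

Local Open Scope classical_set_scope.
Local Open Scope ring_scope.

(* R^n is 'cV[R]_n, so that an n x n matrix acts by left multiplication.
   Matrices carry the Borel sigma-algebra of the (entrywise) product topology,
   i.e. of the usual topology of R^(m * n). *)
Section matrix_borel.
Context (R : realType) (m n : nat).

Let borel_set0 : <<s @open 'M[R]_(m, n) >> set0.
Proof. exact: sigma_algebra0. Qed.

Let borel_setC (A : set 'M[R]_(m, n)) :
  <<s @open 'M[R]_(m, n) >> A -> <<s @open 'M[R]_(m, n) >> (~` A).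
Proof. exact: sigma_algebraC. Qed.

Let borel_bigcup (F : (set 'M[R]_(m, n))^nat) :
  (forall i, <<s @open 'M[R]_(m, n) >> (F i)) ->
  <<s @open 'M[R]_(m, n) >> (\bigcup_i (F i)).
Proof. exact: sigma_algebra_bigcup. Qed.

HB.instance Definition _ :=
  @isMeasurable.Build (sigma_display (@open 'M[R]_(m, n))) 'M[R]_(m, n)
    <<s @open 'M[R]_(m, n) >> borel_set0 borel_setC borel_bigcup.

Lemma mx_open_measurable (A : set 'M[R]_(m, n)) : open A -> measurable A.
Proof. exact: sub_sigma_algebra. Qed.

Lemma measurable_mx_coord (i : 'I_m) (j : 'I_n) :
  measurable_fun setT (fun M : 'M[R]_(m, n) => M i j).
Proof.
apply: (measurability _ (RGenOpens.measurableE R)) => _ [_ [a [b ->]] <-].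
rewrite setTI; apply: mx_open_measurable.
apply: open_comp; last exact: interval_open.
by move=> M _; exact: coord_continuous.
Qed.

(* Every open set is a countable union of rational cubes; hence the Borel
   sigma-algebra is generated by the coordinates. *)
Let cube (p : 'M[rat]_(m, n) * nat) : set 'M[R]_(m, n) :=
  [set M | forall i j, `|ratr (p.1 i j) - M i j| < p.2.+1%:R^-1].

Let open_cubes (A : set 'M[R]_(m, n)) : open A ->
  A = \bigcup_(p in [set p | cube p `<=` A]) cube p.
Proof.
move=> oA; apply/seteqP; split=> [M AM|M [p pA]]; last exact: pA.
have /nbhs_ballP[e /= e0 eA] : nbhs M A by exact: open_nbhs_nbhs.
have [k _ /(_ k (leqnn k)) ke] := near_infty_natSinv_lt (PosNum (divr_gt0 e0 (ltr0n R 2))).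
have qM (i : 'I_m) (j : 'I_n) : exists q : rat, `|ratr q - M i j| < k.+1%:R^-1.
  have /rat_in_itvoo[q] : M i j < M i j + k.+1%:R^-1 by rewrite ltrDl invr_gt0.
  rewrite in_itv/= => /andP[q1 q2]; exists q.
  by rewrite gtr0_norm ?subr_gt0// ltrBlDl.
have [q Hq] : exists q : 'M[rat]_(m, n),
    forall i j, `|ratr (q i j) - M i j| < k.+1%:R^-1.
  exists (\matrix_(i, j) sval (cid (qM i j))) => i j.
  by rewrite mxE; case: cid.
exists (q, k) => // N qN; apply: eA; split => // i j.
rewrite /ball/=.
have /= qNij := qN i j.
rewrite -(subrK (ratr (q i j)) (M i j)) -addrA.
rewrite (le_lt_trans (ler_normD _ _))// (splitr e) ltrD//.
  by rewrite distrC (lt_trans (Hq i j)).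
exact: lt_trans qNij _.
Qed.

Lemma measurable_mxP d (T : measurableType d) (f : T -> 'M[R]_(m, n)) :
  (forall i j, measurable_fun setT (fun x => f x i j)) ->
  measurable_fun setT f.
Proof.
move=> mf; apply: (@measurability _ _ _ _ _ _ (@open 'M[R]_(m, n))) => //.
move=> _ [A oA <-]; rewrite setTI (open_cubes oA) preimage_bigcup.
rewrite bigcup_mkcond; apply: countable_bigcupT_measurable => // p.
case: ifPn => // _.
have -> : f @^-1` cube p = \bigcap_(ij in [set: 'I_m * 'I_n])
    ((fun x => f x ij.1 ij.2) @^-1` (ball (ratr (p.1 ij.1 ij.2) : R) p.2.+1%:R^-1)).
  apply/seteqP; split=> [x fx [i j] _|x fx i j]; first exact: fx.
  exact: (fx (i, j)).
apply: fin_bigcap_measurable => [|[i j] _]; first exact: finite_finset.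
rewrite -[X in measurable X]setTI; apply: mf => //.
by apply: open_measurable; exact: ball_open.
Qed.

End matrix_borel.

Section gaussian.
Context {R : realType}.

Definition cons_cV (n : nat) (p : measurableTypeR R * 'cV[R]_n) : 'cV[R]_n.+1 :=
  col_mx (const_mx p.1 : 'cV[R]_1) p.2.

Lemma cons_cV0 n (p : measurableTypeR R * 'cV[R]_n) : cons_cV p ord0 ord0 = p.1.
Proof.
by rewrite /cons_cV mxE; case: splitP => // j _; rewrite mxE.
Qed.

Lemma cons_cVS n (p : measurableTypeR R * 'cV[R]_n) i :
  cons_cV p (lift ord0 i) ord0 = p.2 i ord0.
Proof.
rewrite /cons_cV mxE; case: splitP => [j|j]; rewrite lift0.
  by move=> ij; have := ltn_ord j; rewrite -ij.
by move=> [ij]; congr (p.2 _ _); exact/val_inj.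
Qed.

Lemma measurable_cons_cV n : measurable_fun setT (@cons_cV n).
Proof.
apply: measurable_mxP => i j; rewrite ord1.
case: (unliftP ord0 i) => [k ->|->].
  under eq_fun do rewrite cons_cVS.
  apply: (@measurableT_comp _ _ _ _ _ _ (fun M : 'cV[R]_n => M k ord0)) => //.
  exact: measurable_mx_coord.
under eq_fun do rewrite cons_cV0.
exact: measurable_fst.
Qed.

HB.instance Definition _ n :=
  @isMeasurableFun.Build _ _ _ _ (@cons_cV n) (@measurable_cons_cV n).

(* gamma_n: the law of a vector of n independent N(0, 1) coordinates
   (see gaussian_box) *)
Fixpoint gaussian (n : nat) : probability 'cV[R]_n R :=
  match n with
  | 0 => dirac (0 : 'cV[R]_0)
  | k.+1 => distribution (normal_prob 0 1 \x gaussian k)%E (@cons_cV k)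
  end.

Lemma gaussian_box n (A : 'I_n -> set (measurableTypeR R)) :
    (forall i, measurable (A i)) ->
  gaussian n [set x | forall i, A i (x i ord0)] =
  (\prod_(i < n) normal_prob 0 1 (A i))%E.
Proof.
elim: n A => [|n IHn] A mA.
  by rewrite big_ord0 /= diracE mem_set// => -[].
rewrite big_ord_recl -IHn; last by move=> i; exact: mA.
have mB : measurable [set x : 'cV[R]_n | forall i, A (lift ord0 i) (x i ord0)].
  rewrite (_ : mkset _ = \bigcap_(i in [set: 'I_n])
    ((fun x : 'cV[R]_n => x i ord0) @^-1` A (lift ord0 i))).
    apply: fin_bigcap_measurable => [|i _]; first exact: finite_finset.
    by rewrite -[X in measurable X]setTI; apply: measurable_mx_coord => //; exact: mA.
  by apply/seteqP; split=> [x xA i _|x xA i]; exact: xA.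
rewrite -product_measure1E//=.
rewrite /distribution/= /pushforward; congr (product_measure1 _ _ _).
apply/seteqP; split=> [p Ap|p [p1 p2] i].
  split; first by have := Ap ord0; rewrite cons_cV0.
  by move=> i; have := Ap (lift ord0 i); rewrite cons_cVS.
by case: (unliftP ord0 i) => [k ->|->]; rewrite ?cons_cVS ?cons_cV0//; exact: p2.
Qed.

End gaussian.

Section definitions.
Context {R : realType}.

Definition symmetric_convex_body (n : nat) (D : set 'cV[R]_n) : Prop :=
  [/\ compact D, convex_set D, D° !=set0 & D = -%R @` D].

Definition dilate (n : nat) (r : R) (D : set 'cV[R]_n) : set 'cV[R]_n :=
  [set r *: y | y in D].

Definition body_norm (n : nat) (D : set 'cV[R]_n) (x : 'cV[R]_n) : R :=
  inf [set r : R | 0 < r /\ dilate r D x].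

(* The library's norm on matrices is the sup norm. *)
Definition norm2 (n : nat) (x : 'cV[R]_n) : R :=
  Num.sqrt (\sum_(i < n) x i ord0 ^+ 2).

Definition is_median d (T : measurableType d) (P : probability T R)
    (f : T -> R) (a : R) : Prop :=
  ((2^-1)%:E <= P [set x | (f x <= a)%R])%E /\
  ((2^-1)%:E <= P [set x | (a <= f x)%R])%E.

Definition is_maximum (A : set R) (a : R) : Prop := A a /\ ubound A a.

(* The set whose maximum is t_{D, delta}; m stands for the median m(D). *)
Definition t_set (n : nat) (D : set 'cV[R]_n) (delta m : R) : set R :=
  [set t : R | 0 < t /\
    (gaussian n (dilate (2 * t * m)%R D) <=
      ((2 `^ delta * expR 1) ^- n)%R%:E)%E].

Definition orthogonal_group (n : nat) : set 'M[R]_n :=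
  [set U | U^T *m U = 1%:M].
Arguments orthogonal_group n : clear implicits.

(* The Haar probability measure of O(n), viewed as a Borel measure on the
   n x n matrices carried by the closed set O(n). *)
Definition is_haar_orthogonal (n : nat) (nu : probability 'M[R]_n R) : Prop :=
  nu (orthogonal_group n) = 1%E /\
  forall (V : 'M[R]_n) (A : set 'M[R]_n),
    orthogonal_group n V -> measurable A -> nu [set V *m U | U in A] = nu A.

(* {-1, 1}^n is encoded by {ffun 'I_n -> bool}, with true standing for -1. *)
Definition sign (n : nat) (eps : {ffun 'I_n -> bool}) (i : 'I_n) : R :=
  (-1) ^+ eps i.

End definitions.

Arguments orthogonal_group {R} n.

(* Main.v *)
From HB Require Import structures.
Require Import Defs.
From mathcomp Require Import all_boot all_order all_algebra.
From mathcomp Require Import all_classical all_reals all_analysis.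
From mathcomp Require Import measurable_realfun ring lra.

Import Order.TTheory GRing.Theory Num.Theory.
Import numFieldNormedType.Exports.

Local Open Scope classical_set_scope.
Local Open Scope ring_scope.

Set Implicit Arguments.
Unset Strict Implicit.
Unset Printing Implicit Defensive.

(** Put [r = 2 sqrt n] and [K = 2 t m D], so that [gamma K <= (2^delta e)^-n].
    By a union bound over [S] and homogeneity, it is enough to show that the
    rotation invariant measure [b] of the set of points of the sphere of radius
    [r] lying in [K] is at most [gamma K].  Integration in polar coordinates only
    gives [gamma K >= b * P(|G| <= r)], and the missing factor has to be
    recovered from convexity.

    For this we compare [b] with its analogue [b'] on the sphere of radius
    [2 r / 3].  Restrict [K] to a random two-dimensional plane.  In a plane, a
    symmetric convex set meeting the circle of radius [r] in a proportion [a] of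
    its length meets the circle of radius [2 r / 3] in a proportion at least
    [min (1, 3 a / 2)], and [min (1, 3 a / 2) >= 3 a / 2 - w / 2], where
    [w >= 2 a - 1] is the proportion of the points of the circle that remain in
    [K] after a rotation by a given angle as well.  Taking the angle between a
    fixed vector and its image by an independent random rotation, the mean of
    [w] is [b^2], whence [b' >= 3 b / 2 - b^2 / 2].

    Since [E |G|^2 = n], combining both radii yields
    [gamma K >= 3/4 (3 b / 2 - b^2 / 2)], which is at least [b] as soon as
    [b <= 1/3]; the latter follows from [3/4 b <= gamma K <= e^-n] when [n > 1].
    For [n = 1], [b] is [0] or [1].

    The polar decomposition is replaced by Fubini's theorem for the product of
    the Gaussian and the Haar measures. *)

(** * Integration against a measure with a density *)

Section density.
Local Open Scope ereal_scope.
Context d (T : measurableType d) (R : realType).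
Variables (mu nu : {measure set T -> \bar R}) (g : T -> R).
Hypothesis mg : measurable_fun setT g.
Hypothesis g0 : forall x, (0 <= g x)%R.
Hypothesis nuE : forall A, measurable A -> nu A = \int[mu]_(x in A) (g x)%:E.

Import HBNNSimple.

(** A simple function is a finite sum of multiples of indicators of its level sets, and on each
    level set the claim is [nuE]. *)
Let density_nnsfun (f : {nnsfun T >-> R}) :
  \int[nu]_x (f x)%:E = \int[mu]_x ((f x)%:E * (g x)%:E).
Proof.
under [LHS]eq_integral do rewrite fimfunE -fsumEFin//.
rewrite [LHS]ge0_integral_fsum//; last 2 first.
- by move=> r; exact/measurable_EFinP/measurableT_comp.
- by move=> r x _; rewrite EFinM nnfun_muleindic_ge0.
under [RHS]eq_integral.
  move=> x _; rewrite fimfunE -fsumEFin// ge0_mule_fsuml; last first.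
    by move=> r; rewrite EFinM nnfun_muleindic_ge0.
  over.
have mfg r : measurable_fun setT
    (fun x => (r * \1_(f @^-1` [set r]) x)%:E * (g x)%:E).
  apply: emeasurable_funM; apply/measurable_EFinP => //.
  exact: measurable_funM.
rewrite [RHS]ge0_integral_fsum//; last first.
  by move=> r x _; rewrite mule_ge0 ?lee_fin// -lee_fin EFinM nnfun_muleindic_ge0.
apply: eq_fsbigr => r _; rewrite integralZl_indic_nnsfun//=.
rewrite integral_indic// setIT nuE// [in LHS]integral_mkcond.
(* A negative value has an empty level set, so both sides vanish; a nonnegative one can be pulled
   out of the integral. *)
have [r0|r0] := leP 0%R r; last first.
  rewrite preimage_nnfun0//.
  rewrite integral0_eq ?mule0 => [|x _]; last by rewrite patchE in_set0.
  by rewrite integral0_eq// => x _; rewrite indic0 mulr0 mul0e.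
rewrite -ge0_integralZl//; last 2 first.
- apply: (measurable_restrictT _ _).1 => //.
  by apply/measurable_EFinP; exact: measurable_funTS.
- by move=> x _; rewrite patchE; case: ifP; rewrite ?lee_fin.
apply: eq_integral => x _; rewrite patchE indicE EFinM -muleA.
by case: ifP => _; rewrite ?mul1e ?mul0e.
Qed.

(** Monotone convergence along simple functions increasing to [f]. This turns integrals for the
    normal law into Lebesgue integrals, where changes of variables are available. *)
Lemma ge0_integral_density (f : T -> \bar R) :
    measurable_fun setT f -> (forall x, 0 <= f x) ->
  \int[nu]_x f x = \int[mu]_x (f x * (g x)%:E).
Proof.
move=> mf f0; pose f_ := nnsfun_approx measurableT mf.
have f_nd x : {homo (fun n => (f_ n x)%:E) : n m / (n <= m)%N >-> n <= m}.
  by move=> m n mn; rewrite lee_fin; exact/lefP/nd_nnsfun_approx.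
have f_cvg x : (f_ n x)%:E @[n --> \oo] --> f x by exact: cvg_nnsfun_approx.
transitivity (limn (fun n => \int[nu]_x (f_ n x)%:E)).
  rewrite -monotone_convergence//.
  - by apply: eq_integral => x _; apply/esym/cvg_lim.
  - by move=> n; exact/measurable_EFinP.
  - by move=> n x _; rewrite lee_fin.
under eq_fun do rewrite density_nnsfun.
rewrite -monotone_convergence//.
- apply: eq_integral => x _; apply/cvg_lim => //.
  exact/cvgeZr.
- by move=> n; apply: emeasurable_funM; exact/measurable_EFinP.
- by move=> n x _; rewrite mule_ge0// lee_fin.
- by move=> x _ m n mn; apply: lee_wpmul2r; [rewrite lee_fin|exact: f_nd].
Qed.

End density.

(** * The Gaussian measure of the plane *)

Section lebesgue_translation.
Local Open Scope ereal_scope.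
Context (R : realType).
Notation mu := (@lebesgue_measure R).
Implicit Type t : R.

Lemma measurable_addr t :
  measurable_fun setT (fun x : measurableTypeR R => (x + t)%R : measurableTypeR R).
Proof. exact: measurable_funD. Qed.

(** The translated measure gives half-open intervals their length, and this characterises the
    Lebesgue measure. *)
Lemma lebesgue_measureD t (A : set (measurableTypeR R)) : measurable A ->
  mu ((fun x => x + t)%R @^-1` A) = mu A.
Proof.
move=> mA; pose phi (x : measurableTypeR R) : measurableTypeR R := (x + t)%R.
have mphi : measurable_fun setT phi by exact: measurable_addr.
pose phi' : {mfun _ >-> _} := HB.pack phi (isMeasurableFun.Build _ _ _ _ _ mphi).
apply/esym.
apply: (@lebesgue_measure_unique R (pushforward mu phi')) => //= _ [[a b]] _ <-.
rewrite /pushforward /=.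
have -> : phi @^-1` `]a, b] = `](a - t)%R, (b - t)%R]%classic.
  by apply/seteqP; split=> x /=; rewrite !in_itv/= /phi ltrBlDr lerBrDr.
rewrite !lebesgue_measure_itv/= !lte_fin ltrD2r; case: ifP => // _.
by rewrite -!EFinB; congr EFin; lra.
Qed.

Lemma ge0_integral_translation t (f : R -> \bar R) :
    measurable_fun setT f -> (forall x, 0 <= f x) ->
  \int[mu]_x f (x + t)%R = \int[mu]_x f x.
Proof.
move=> mf f0; pose phi (x : measurableTypeR R) : measurableTypeR R := (x + t)%R.
have mphi : measurable_fun setT phi by exact: measurable_addr.
have := @ge0_integral_pushforward _ _ _ _ R phi mphi mu setT f measurableT mf
  (fun y _ => f0 y).
rewrite preimage_setT => <-.
by apply: eq_measure_integral => A mA _; exact: lebesgue_measureD.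
Qed.

End lebesgue_translation.

Section plane.
Local Open Scope ereal_scope.
Context (R : realType).
Notation mu := (@lebesgue_measure R).
Notation N01 := (@normal_prob R 0 1).

Definition rot (c s : R) (p : R * R) : R * R :=
  (c * p.1 - s * p.2, s * p.1 + c * p.2)%R.

Lemma measurable_rot c s : measurable_fun setT (rot c s).
Proof.
apply/measurable_fun_pairP; split.
  by apply: measurable_funB; apply: measurable_funM.
by apply: measurable_funD; apply: measurable_funM.
Qed.

(** After exchanging the integrals, the shear is, for fixed [y], a translation in [x]. *)
Lemma ge0_integral_shear1 t (f : R * R -> \bar R) :
    measurable_fun setT f -> (forall x, 0 <= f x) ->
  \int[mu]_x \int[mu]_y f (x + t * y, y)%R = \int[mu]_x \int[mu]_y f (x, y).
Proof.
move=> mf f0.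
have ms : measurable_fun setT (fun p : R * R => (p.1 + t * p.2, p.2)%R).
  apply/measurable_fun_pairP; split; last exact: measurable_snd.
  by apply: measurable_funD => //; exact: measurable_funM.
have := @fubini_tonelli _ _ _ _ R mu mu (fun p : R * R => f (p.1 + t * p.2, p.2)%R)
  (measurableT_comp mf ms) (fun=> f0 _).
move=> /= ->; rewrite [RHS](@fubini_tonelli _ _ _ _ R mu mu f mf f0).
apply: eq_integral => y _.
rewrite (ge0_integral_translation (t * y) (f := fun x => f (x, y)))//.
exact: measurableT_comp.
Qed.

Lemma ge0_integral_shear2 t (f : R * R -> \bar R) :
    measurable_fun setT f -> (forall x, 0 <= f x) ->
  \int[mu]_x \int[mu]_y f (x, y + t * x)%R = \int[mu]_x \int[mu]_y f (x, y).
Proof.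
move=> mf f0; apply: eq_integral => x _.
rewrite (ge0_integral_translation (t * x) (f := fun y => f (x, y)))//.
exact: measurableT_comp.
Qed.

(** A rotation of angle [u] with [sin u != 0] is the product of three shears [S1 S2 S1], with
    parameters [t], [s], [t] where [t = (cos u - 1) / sin u = - tan (u / 2)]. Each shear preserves
    the double integral. *)
Let ge0_integral_rot_sn0 c s (f : R * R -> \bar R) :
    (s != 0)%R -> (c ^+ 2 + s ^+ 2 = 1)%R ->
    measurable_fun setT f -> (forall x, 0 <= f x) ->
  \int[mu]_x \int[mu]_y f (rot c s (x, y)) = \int[mu]_x \int[mu]_y f (x, y).
Proof.
move=> s0 cs1 mf f0; pose t := ((c - 1) / s)%R.
pose S1 (p : R * R) := (p.1 + t * p.2, p.2)%R.
pose S2 (p : R * R) := (p.1, p.2 + s * p.1)%R.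
have mS1 : measurable_fun setT S1.
  apply/measurable_fun_pairP; split; last exact: measurable_snd.
  by apply: measurable_funD => //; exact: measurable_funM.
have mS2 : measurable_fun setT S2.
  apply/measurable_fun_pairP; split; first exact: measurable_fst.
  by apply: measurable_funD => //; exact: measurable_funM.
have rotE p : rot c s p = S1 (S2 (S1 p)).
  have tE : (1 + t * s = c)%R by rewrite /t divfK//; lra.
  have tcE : (t * (c + 1) = - s)%R.
    by apply: (mulIf s0); rewrite /t mulrAC divfK//; nra.
  rewrite /rot /S1 /S2 /=; congr pair.
    transitivity ((1 + t * s) * p.1 + (t * (c + 1)) * p.2)%R.
      by rewrite tE tcE; ring.
    by rewrite -tE; ring.
  by rewrite -[in LHS]tE; ring.
under eq_integral do under eq_integral do rewrite rotE.
have mf1 : measurable_fun setT (f \o S1) by exact: measurableT_comp.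
have mf2 : measurable_fun setT (f \o S1 \o S2) by exact: measurableT_comp.
have := @ge0_integral_shear1 t (f \o S1 \o S2) mf2 (fun=> f0 _).
move=> /= ->.
have := @ge0_integral_shear2 s (f \o S1) mf1 (fun=> f0 _).
move=> /= ->.
exact: ge0_integral_shear1.
Qed.

Lemma ge0_integral_rot c s (f : R * R -> \bar R) :
    (c ^+ 2 + s ^+ 2 = 1)%R ->
    measurable_fun setT f -> (forall x, 0 <= f x) ->
  \int[mu]_x \int[mu]_y f (rot c s (x, y)) = \int[mu]_x \int[mu]_y f (x, y).
Proof.
move=> cs1 mf f0; have [s0|] := eqVneq s 0%R; last first.
  by move=> s0; exact: ge0_integral_rot_sn0.
have /orP[/eqP c1|/eqP c1] : ((c == 1) || (c == - 1))%R.
- by rewrite -eqf_sqr expr1n -cs1 s0 expr0n addr0.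
- apply: eq_integral => x _; apply: eq_integral => y _.
  by rewrite /rot c1 s0; congr (f (_, _)) => /=; ring.
(* The remaining case is the half turn [c = -1], which is the quarter turn [rot 0 1] applied
   twice. *)
have mr : measurable_fun setT (f \o rot 0 1).
  by apply: measurableT_comp => //; exact: measurable_rot.
have rq : (0 ^+ 2 + 1 ^+ 2 = 1 :> R)%R by ring.
rewrite -(@ge0_integral_rot_sn0 0%R 1%R f (oner_neq0 R) rq mf f0).
have := @ge0_integral_rot_sn0 0%R 1%R (f \o rot 0 1) (oner_neq0 R) rq mr
  (fun=> f0 _).
move=> /= <-.
apply: eq_integral => x _; apply: eq_integral => y _.
by rewrite /rot c1 s0; congr (f (_, _)) => /=; ring.
Qed.

Lemma ge0_integral_normal_prob (f : R -> \bar R) :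
    measurable_fun setT f -> (forall x, 0 <= f x) ->
  \int[N01]_x f x = \int[mu]_x (f x * (normal_pdf 0 1 x)%:E).
Proof.
move=> mf f0; apply: ge0_integral_density => //.
- exact: measurable_normal_pdf.
- by move=> x; exact: normal_pdf_ge0.
Qed.

(** The product density depends on [p] only through [p.1 ^+ 2 + p.2 ^+ 2]. *)
Lemma normal_pdf_rot c s (p : R * R) : (c ^+ 2 + s ^+ 2 = 1)%R ->
  (normal_pdf 0 1 (rot c s p).1 * normal_pdf 0 1 (rot c s p).2 =
   normal_pdf 0 1 p.1 * normal_pdf 0 1 p.2 :> R)%R.
Proof.
move=> cs1; rewrite !normal_pdfE ?oner_eq0// /normal_fun.
rewrite mulrACA [RHS]mulrACA -!expRD; congr (_ * expR _)%R.
rewrite /rot /= !subr0 expr1n -!mulrDl; congr (_ / _)%R.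
rewrite -!opprD; congr (- _)%R.
transitivity ((c ^+ 2 + s ^+ 2) * (p.1 ^+ 2 + p.2 ^+ 2))%R; first by ring.
by rewrite cs1 mul1r.
Qed.

Lemma ge0_integral_normal2 (f : R * R -> \bar R) :
    measurable_fun setT f -> (forall x, 0 <= f x) ->
  \int[N01]_x \int[N01]_y f (x, y) =
  \int[mu]_x \int[mu]_y (f (x, y) * (normal_pdf 0 1 x * normal_pdf 0 1 y)%:E).
Proof.
move=> mf f0; rewrite ge0_integral_normal_prob; last 2 first.
- exact: measurable_fun_fubini_tonelli_F.
- by move=> x; exact: integral_ge0.
apply: eq_integral => x _; rewrite ge0_integral_normal_prob//; last first.
  exact: measurableT_comp.
rewrite -ge0_integralZr//.
- by apply: eq_integral => y _; rewrite -muleA (muleC (normal_pdf _ _ y)%:E).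
- apply: emeasurable_funM; first exact: measurableT_comp.
  by apply/measurable_EFinP; exact: measurable_normal_pdf.
- by move=> y _; rewrite mule_ge0// lee_fin normal_pdf_ge0.
- by rewrite lee_fin normal_pdf_ge0.
Qed.

Lemma ge0_integral_normal2_rot c s (f : R * R -> \bar R) :
    (c ^+ 2 + s ^+ 2 = 1)%R ->
    measurable_fun setT f -> (forall x, 0 <= f x) ->
  \int[N01]_x \int[N01]_y f (rot c s (x, y)) = \int[N01]_x \int[N01]_y f (x, y).
Proof.
move=> cs1 mf f0; have mr := measurable_rot c s.
have := @ge0_integral_normal2 (f \o rot c s) (measurableT_comp mf mr)
  (fun=> f0 _).
move=> /= ->.
rewrite (@ge0_integral_normal2 f mf f0).
pose g (p : R * R) := f p * (normal_pdf 0 1 p.1 * normal_pdf 0 1 p.2)%:E.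
have mg : measurable_fun setT g.
  apply: emeasurable_funM => //; apply/measurable_EFinP.
  by apply: measurable_funM; (apply: measurableT_comp; last by []);
    exact: measurable_normal_pdf.
have g0 p : 0 <= g p by rewrite mule_ge0// lee_fin mulr_ge0// normal_pdf_ge0.
rewrite -[RHS](@ge0_integral_rot c s g cs1 mg g0).
apply: eq_integral => x _; apply: eq_integral => y _.
by rewrite /g normal_pdf_rot.
Qed.

Lemma normal_second_moment : \int[N01]_x (x ^+ 2)%:E <= 1.
Proof.
have msq : measurable_fun setT (fun x : R => (x ^+ 2)%:E).
  by apply/measurable_EFinP; exact: measurable_funX.
(* [expR y >= 1 + y] with [y = a x^2], whose normal integral is explicit *)
have bound (eta : R) : (0 < eta)%R -> \int[N01]_x (x ^+ 2)%:E <= (1 + 2 * eta)%:E.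
  (* The constant [a] is chosen so that [expR (a * x ^+ 2)] times the standard normal density is
     [sg] times the centred normal density of standard deviation [sg]. The integral of this
     exponential is therefore [sg = 1 + eta]. *)
  move=> eta0; pose sg := (1 + eta)%R; pose a := ((1 - sg ^- 2) / 2)%R.
  have sg0 : (0 < sg)%R by rewrite /sg; lra.
  have sg1 : (1 < sg)%R by rewrite /sg; lra.
  have sgn0 : (sg != 0)%R by rewrite gt_eqF.
  have a0 : (0 < a)%R.
    rewrite /a divr_gt0// subr_gt0 invf_lt1 ?exprn_gt0//.
    by rewrite exprn_egt1.
  have peakE : (normal_peak 1 = sg * normal_peak sg)%R.
    rewrite /normal_peak expr1n mul1r -mulrnAr sqrtrM ?sqr_ge0// sqrtr_sqr.
    by rewrite gtr0_norm// invfM mulrA divff// mul1r.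
  have pdfE (x : R) :
      (expR (a * x ^+ 2) * normal_pdf 0 1 x = sg * normal_pdf 0 sg x)%R.
    rewrite !normal_pdfE ?oner_eq0// /normal_fun mulrCA -expRD !subr0 peakE -mulrA.
    congr (_ * (_ * expR _))%R.
    by rewrite /a; field.
  have : \int[N01]_x (1 + a * x ^+ 2)%:E <= sg%:E.
    apply: (@le_trans _ _ (\int[N01]_x (expR (a * x ^+ 2))%:E)).
      apply: ge0_le_integral => //.
      - by move=> x _; rewrite lee_fin addr_ge0// mulr_ge0 ?sqr_ge0// ltW.
      - apply/measurable_EFinP; apply: measurable_funD => //.
        by apply: measurable_funM => //; exact: measurable_funX.
      - apply/measurable_EFinP; apply: measurableT_comp => //.
        by apply: measurable_funM => //; exact: measurable_funX.
      - by move=> x _; rewrite lee_fin expR_ge1Dx.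
    rewrite ge0_integral_normal_prob; last 2 first.
    - apply/measurable_EFinP; apply: measurableT_comp => //.
      by apply: measurable_funM => //; exact: measurable_funX.
    - by move=> x; rewrite lee_fin expR_ge0.
    under eq_integral do rewrite -EFinM pdfE EFinM.
    rewrite ge0_integralZl//; last 3 first.
    - by apply/measurable_EFinP; exact: measurable_normal_pdf.
    - by move=> x _; rewrite lee_fin normal_pdf_ge0.
    - by rewrite lee_fin ltW.
    by rewrite integral_normal_pdf mule1.
  under eq_integral do rewrite EFinD EFinM.
  rewrite ge0_integralD//; last 2 first.
  - by move=> x _; rewrite mule_ge0 ?lee_fin ?sqr_ge0// ltW.
  - by apply: emeasurable_funM.
  rewrite integral_cst// mul1e.
  rewrite [X in X + _](_ : _ = 1); last exact: (@probability_setT _ _ R N01).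
  rewrite ge0_integralZl//; last 2 first.
  - by move=> x _; rewrite lee_fin sqr_ge0.
  - by rewrite lee_fin ltW.
  set I := (\int[_]_x _).
  have I0 : 0 <= I by apply: integral_ge0 => x _; rewrite lee_fin sqr_ge0.
  case: I I0 => [r| |] //; last by rewrite gt0_muley.
  rewrite -EFinM -EFinD !lee_fin => r0.
  (* The inequality [1 + a r <= 1 + eta] gives [r <= eta / a = 2 (1 + eta)^2 / (2 + eta)], which is
     at most [1 + 2 eta]. *)
  have -> : (a = eta * (2 + eta) / (2 * (1 + eta) ^+ 2))%R.
    by rewrite /a /sg; field; rewrite gt_eqF//; lra.
  rewrite /sg => H.
  have e1 : (0 < (1 + eta) ^+ 2)%R by rewrite exprn_gt0//; lra.
  have : (eta * (2 + eta) * r <= eta * (2 * (1 + eta) ^+ 2))%R.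
    have : (eta * (2 + eta) / (2 * (1 + eta) ^+ 2) * r <= eta)%R by lra.
    by rewrite mulrAC ler_pdivrMr ?mulr_gt0.
  rewrite -mulrA ler_pM2l// => H2.
  rewrite -(@ler_pM2l _ (2 + eta)%R); last by lra.
  by apply: le_trans H2 _; nra.
apply/lee_addgt0Pr => e e0.
by apply: (le_trans (bound (e / 2)%R _)); [rewrite divr_gt0|rewrite mulrC divfK].
Qed.

End plane.

(** * Rotation invariance of the Gaussian measure *)

Lemma closed_mx_measurable (R : realType) m n (A : set 'M[R]_(m, n)) :
  closed A -> measurable A.
Proof.
move=> cA; rewrite -[A]setCK; apply: measurableC; apply: mx_open_measurable.
exact: closed_openC.
Qed.

(** * Measurability of matrix operations *)

Section matrix_measurability.
Context (R : realType) d (T : measurableType d).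

Lemma measurable_mulmx m n p (f : T -> 'M[R]_(m, n)) (g : T -> 'M[R]_(n, p)) :
  measurable_fun setT f -> measurable_fun setT g ->
  measurable_fun setT (fun t => f t *m g t).
Proof.
move=> mf mg; apply: measurable_mxP => i j.
under eq_fun do rewrite mxE.
apply: measurable_sum => k; apply: measurable_funM.
  exact: (measurableT_comp (measurable_mx_coord i k) mf).
exact: (measurableT_comp (measurable_mx_coord k j) mg).
Qed.

Lemma measurable_scalemx m n (f : T -> R) (g : T -> 'M[R]_(m, n)) :
  measurable_fun setT f -> measurable_fun setT g ->
  measurable_fun setT (fun t => f t *: g t).
Proof.
move=> mf mg; apply: measurable_mxP => i j.
under eq_fun do rewrite mxE.
apply: measurable_funM => //.
exact: (measurableT_comp (measurable_mx_coord i j) mg).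
Qed.

Lemma measurable_addmx m n (f g : T -> 'M[R]_(m, n)) :
  measurable_fun setT f -> measurable_fun setT g ->
  measurable_fun setT (fun t => f t + g t).
Proof.
move=> mf mg; apply: measurable_mxP => i j.
under eq_fun do rewrite mxE.
apply: measurable_funD.
  exact: (measurableT_comp (measurable_mx_coord i j) mf).
exact: (measurableT_comp (measurable_mx_coord i j) mg).
Qed.

Lemma measurable_trmx m n (f : T -> 'M[R]_(m, n)) :
  measurable_fun setT f -> measurable_fun setT (fun t => (f t)^T).
Proof.
move=> mf; apply: measurable_mxP => i j.
under eq_fun do rewrite mxE.
exact: (measurableT_comp (measurable_mx_coord j i) mf).
Qed.

Lemma measurable_set_comp d' (T' : measurableType d') (f : T -> T') (A : set T') :
  measurable_fun setT f -> measurable A -> measurable [set t | A (f t)].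
Proof. by move=> mf mA; rewrite -[X in measurable X]setTI; exact: mf. Qed.

End matrix_measurability.

(** * Orthogonal matrices and the Euclidean norm *)

Section euclidean.
Context (R : realType).

Lemma orthogonalP n (U : 'M[R]_n) : orthogonal_group n U -> U *m U^T = 1%:M.
Proof. by move=> /mulmx1C. Qed.

Lemma orthogonal_tr n (U : 'M[R]_n) :
  orthogonal_group n U -> orthogonal_group n U^T.
Proof. by move=> oU; rewrite /orthogonal_group/= trmxK orthogonalP. Qed.

Lemma orthogonal_mul n (U V : 'M[R]_n) :
  orthogonal_group n U -> orthogonal_group n V -> orthogonal_group n (U *m V).
Proof.
rewrite /orthogonal_group/= => oU oV.
by rewrite trmx_mul mulmxA -(mulmxA V^T) oU mulmx1.
Qed.

Lemma orthogonal1 n : orthogonal_group n (1%:M : 'M[R]_n).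
Proof. by rewrite /orthogonal_group/= trmx1 mulmx1. Qed.

Lemma dotmxE n (x y : 'cV[R]_n) : (x^T *m y) ord0 ord0 = \sum_i x i ord0 * y i ord0.
Proof. by rewrite mxE; apply: eq_bigr => i _; rewrite mxE. Qed.

Lemma norm2E n (x : 'cV[R]_n) : norm2 x = Num.sqrt ((x^T *m x) ord0 ord0).
Proof.
by rewrite dotmxE; congr Num.sqrt; apply: eq_bigr => i _; rewrite expr2.
Qed.

Lemma norm2_ge0 n (x : 'cV[R]_n) : 0 <= norm2 x.
Proof. exact: sqrtr_ge0. Qed.

Lemma sqr_norm2 n (x : 'cV[R]_n) : norm2 x ^+ 2 = \sum_i x i ord0 ^+ 2.
Proof. by rewrite sqr_sqrtr// sumr_ge0// => i _; exact: sqr_ge0. Qed.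

Lemma norm2Z n a (x : 'cV[R]_n) : norm2 (a *: x) = `|a| * norm2 x.
Proof.
rewrite /norm2; under eq_bigr do rewrite mxE exprMn.
by rewrite -mulr_sumr sqrtrM ?sqr_ge0// sqrtr_sqr.
Qed.

Lemma norm2_eq0 n (x : 'cV[R]_n) : (norm2 x == 0) = (x == 0).
Proof.
apply/eqP/eqP => [x0|->]; last first.
  by rewrite /norm2 big1 ?sqrtr0// => i _; rewrite mxE expr0n.
have : norm2 x ^+ 2 = 0 by rewrite x0 expr0n.
rewrite sqr_norm2 => /eqP; rewrite psumr_eq0; last by move=> i _; exact: sqr_ge0.
move=> /allP x2; apply/colP => i; rewrite mxE; apply/eqP.
by rewrite -sqrf_eq0; apply: x2; rewrite mem_index_enum.
Qed.

Lemma norm2_orthogonal n (U : 'M[R]_n) x :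
  orthogonal_group n U -> norm2 (U *m x) = norm2 x.
Proof.
by move=> oU; rewrite !norm2E trmx_mul mulmxA -(mulmxA x^T) oU mulmx1.
Qed.

Definition cV0 n : 'cV[R]_n.+1 := delta_mx ord0 ord0.

Lemma norm2_cV0 n : norm2 (cV0 n) = 1.
Proof.
rewrite /norm2 (bigD1 ord0)//= big1 => [|i i0]; last first.
  by rewrite mxE (negbTE i0) expr0n.
by rewrite mxE eqxx expr1n addr0 sqrtr1.
Qed.

Lemma cV0E n : cV0 n = col_mx (1%:M : 'M[R]_1) (0 : 'cV[R]_n) :> 'cV[R]_(1 + n).
Proof.
apply/colP => i; rewrite [RHS]mxE mxE; case: (splitP i) => [j ij|k ik].
  have -> : i = ord0 by apply/val_inj; rewrite /= ij ord1.
  by rewrite mxE (ord1 j).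
by rewrite mxE; have /negbTE-> : i != ord0 by rewrite -val_eqE /= ik.
Qed.

Lemma sqr_norm2_col_mx n a (w : 'cV[R]_n) :
  norm2 (col_mx (a%:M : 'M[R]_1) w : 'cV[R]_(1 + n)) ^+ 2 = a ^+ 2 + norm2 w ^+ 2.
Proof.
rewrite !sqr_norm2 big_split_ord/= big_ord1 col_mxEu mxE eqxx.
by congr (_ + _); apply: eq_bigr => i _; rewrite col_mxEd.
Qed.

End euclidean.

Lemma integral_probability_cst d (T : measurableType d) (R : realType)
  (P : probability T R) (c : \bar R) : (\int[P]_x c = c)%E.
Proof.
rewrite integral_cst// [X in (_ * X)%E](_ : _ = 1%E) ?mule1//.
exact: (@probability_setT _ _ R P).
Qed.

(** * Gaussian invariance under rotations of the first two coordinates *)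

Section gaussian_rotation.
Context (R : realType).
Notation N01 := (@normal_prob R 0%R 1%R).
Local Open Scope ereal_scope.

Lemma cons_cVE n (p : measurableTypeR R * 'cV[R]_n) :
  cons_cV p = col_mx (p.1%:M : 'M[R]_1) p.2.
Proof.
rewrite /cons_cV (_ : const_mx p.1 = p.1%:M)//.
by apply/matrixP => i j; rewrite !mxE !ord1.
Qed.

Lemma ge0_integral_gaussianS n (f : 'cV[R]_n.+1 -> \bar R) :
    measurable_fun setT f -> (forall x, 0 <= f x) ->
  \int[gaussian n.+1]_x f x = \int[N01]_a \int[gaussian n]_y f (cons_cV (a, y)).
Proof.
move=> mf f0.
have := @ge0_integral_pushforward _ _ _ _ R _ (@measurable_cons_cV R n)
  (N01 \x gaussian n) setT f measurableT mf (fun y _ => f0 y).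
rewrite preimage_setT => H.
transitivity (\int[N01 \x gaussian n]_p f (cons_cV p)); first exact: H.
rewrite fubini_tonelli1//; first exact: measurableT_comp.
Qed.

Lemma gaussianSE n (A : set 'cV[R]_n.+1) :
  gaussian n.+1 A = \int[N01]_a gaussian n [set y | A (cons_cV (a, y))].
Proof.
apply: eq_integral => a _ /=; congr (gaussian n _).
by apply/seteqP; split => y /=; rewrite /xsection/= inE.
Qed.

(** Induction on [n]: the squared norm splits off the square of the first coordinate, whose mean is
    at most 1. *)
Lemma gaussian_second_moment n :
  \int[gaussian n]_x (norm2 (x : 'cV[R]_n) ^+ 2)%:E <= n%:R%:E.
Proof.
have mn k : measurable_fun setT (fun x : 'cV[R]_k => (norm2 x ^+ 2)%:E).
  apply/measurable_EFinP; under eq_fun do rewrite sqr_norm2.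
  apply: measurable_sum => i; apply: measurable_funX; exact: measurable_mx_coord.
elim: n => [|n IHn].
  by rewrite integral0_eq// => x _; rewrite sqr_norm2 big_ord0.
rewrite ge0_integral_gaussianS//; last by move=> x; rewrite lee_fin sqr_ge0.
have E (a : R) :
    \int[gaussian n]_y (norm2 (cons_cV (a : measurableTypeR R, y)) ^+ 2)%:E =
    (a ^+ 2)%:E + \int[gaussian n]_y (norm2 y ^+ 2)%:E.
  under eq_integral do rewrite cons_cVE sqr_norm2_col_mx EFinD /=.
  rewrite ge0_integralD//; last 2 first.
  - by move=> x _; rewrite lee_fin sqr_ge0.
  - by move=> x _; rewrite lee_fin sqr_ge0.
  by rewrite (integral_probability_cst (gaussian n)).
under eq_integral do rewrite E.
rewrite ge0_integralD//; last 3 first.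
- by move=> x _; rewrite lee_fin sqr_ge0.
- by apply/measurable_EFinP; exact: measurable_funX.
- by move=> x _; apply: integral_ge0 => y _; rewrite lee_fin sqr_ge0.
rewrite (integral_probability_cst N01) -natr1 addrC EFinD.
by apply: leeD => //; exact: normal_second_moment.
Qed.

(** Stated for a single matrix, so that invariance can be propagated through products and block
    extensions before it is known on all of O(n). *)
Definition gaussian_preserving n (U : 'M[R]_n) : Prop :=
  forall A, measurable A -> gaussian n [set x | A (U *m x)] = gaussian n A.

Lemma measurable_mulmx_cst n (U : 'M[R]_n) :
  measurable_fun setT (fun x : 'cV[R]_n => U *m x).
Proof.
by apply: measurable_mulmx; [exact: measurable_cst|exact: measurable_id].
Qed.

Lemma gaussian_preserving1 n : gaussian_preserving (1%:M : 'M[R]_n).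
Proof.
by move=> A mA; congr (gaussian _ _); apply/seteqP; split=> x /=; rewrite mul1mx.
Qed.

Lemma gaussian_preserving_mul n (U V : 'M[R]_n) :
  gaussian_preserving U -> gaussian_preserving V -> gaussian_preserving (U *m V).
Proof.
move=> pU pV A mA; rewrite -(pU A mA) -(pV [set x | A (U *m x)]).
  by congr (gaussian _ _); apply/seteqP; split => x /=; rewrite mulmxA.
exact: measurable_set_comp (measurable_mulmx_cst U) mA.
Qed.

Definition lift_mx n (U : 'M[R]_n) : 'M[R]_n.+1 :=
  block_mx (1%:M : 'M[R]_1) 0 0 U : 'M[R]_(1 + n).

Lemma lift_mx_cons n (U : 'M[R]_n) a y :
  lift_mx U *m cons_cV (a, y) = cons_cV (a, U *m y).
Proof.
rewrite !cons_cVE/= /lift_mx (@mul_block_col _ 1 n 1 n 1).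
by rewrite mul1mx !mul0mx addr0 add0r.
Qed.

Lemma gaussian_preserving_lift n (U : 'M[R]_n) :
  gaussian_preserving U -> gaussian_preserving (lift_mx U).
Proof.
move=> pU A mA.
rewrite !gaussianSE; apply: eq_integral => a _.
rewrite -(pU [set y | A (cons_cV (a, y))]).
  by congr (gaussian n _); apply/seteqP; split => y /=; rewrite lift_mx_cons.
apply: (measurable_set_comp _ mA).
by apply: (measurableT_comp (@measurable_cons_cV R n)); exact: measurable_pair1.
Qed.

(** This is [rot c s] on the first two coordinates and the identity on the others. *)
Definition givens n (c s : R) : 'M[R]_n.+2 :=
  block_mx (c%:M : 'M[R]_1) (row_mx ((- s)%R%:M : 'M[R]_1) (0 : 'rV[R]_n))
           (col_mx (s%:M : 'M[R]_1) (0 : 'cV[R]_n))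
           (block_mx (c%:M : 'M[R]_1) 0 0 1%:M : 'M[R]_(1 + n)) : 'M[R]_(1 + (1 + n)).

Lemma givens_cons n c s a b (y : 'cV[R]_n) :
  givens n c s *m cons_cV (a, cons_cV (b, y)) =
  cons_cV ((rot c s (a, b)).1, cons_cV ((rot c s (a, b)).2, y)).
Proof.
rewrite !cons_cVE/= /givens (@mul_block_col _ 1 n.+1 1 n.+1 1).
rewrite (@mul_row_col _ 1 1 n 1) (@mul_col_mx _ 1 n 1 1).
rewrite (@mul_block_col _ 1 n 1 n 1) !mul0mx mul1mx !addr0 add0r.
rewrite (@add_col_mx _ 1 n 1) add0r -!scalar_mxM -!raddfD /=.
by rewrite mulNr.
Qed.

(** Integrating out all but the first two coordinates leaves a double normal integral of a function
    [F] on the plane, which is invariant under [rot c s]. *)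
Lemma gaussian_preserving_givens n c s : (c ^+ 2 + s ^+ 2 = 1)%R ->
  gaussian_preserving (givens n c s).
Proof.
move=> cs1 A mA.
have mcons2 : measurable_fun setT (fun q : (R * R) * 'cV[R]_n =>
    cons_cV (q.1.1 : measurableTypeR R, cons_cV (q.1.2 : measurableTypeR R, q.2))).
  apply: (measurableT_comp (@measurable_cons_cV R n.+1)).
  apply: measurable_fun_pair => /=.
    by apply: (measurableT_comp measurable_fst); exact: measurable_fst.
  apply: (measurableT_comp (@measurable_cons_cV R n)).
  apply: measurable_fun_pair => //=.
  by apply: (measurableT_comp measurable_snd); exact: measurable_fst.
pose F (p : R * R) := gaussian n [set y |
  A (cons_cV (p.1 : measurableTypeR R, cons_cV (p.2 : measurableTypeR R, y)))].
have mF : measurable_fun setT F.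
  have := measurable_fun_xsection (gaussian n) (measurable_set_comp mcons2 mA).
  apply: eq_measurable_fun => p _ /=; congr (gaussian n _).
  by apply/seteqP; split => y /=; rewrite /xsection/= inE.
have F0 p : 0 <= F p by exact: measure_ge0.
rewrite !gaussianSE.
under eq_integral do rewrite gaussianSE.
under [RHS]eq_integral do rewrite gaussianSE.
rewrite -[RHS](@ge0_integral_normal2_rot _ c s F cs1 mF F0).
apply: eq_integral => a _; apply: eq_integral => b _; congr (gaussian n _).
by apply/seteqP; split => y /=; rewrite givens_cons.
Qed.

(** The half turn of the plane, applied to a function of the first coordinate alone, yields the
    symmetry of the one-dimensional law. *)
Lemma normal_probN (A : set (measurableTypeR R)) : measurable A ->
  N01 [set x | A (- x)%R] = N01 A.
Proof.
move=> mA.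
have mNA : measurable [set x | A (- x)%R].
  by apply: measurable_set_comp mA; exact: oppr_measurable.
have mI (B : set R) : measurable B ->
    measurable_fun setT (fun p : R * R => (\1_B p.1)%:E : \bar R).
  by move=> mB; apply/measurable_EFinP; apply: measurableT_comp => //.
have E (B : set R) : measurable B ->
    \int[N01]_x \int[N01]_y (\1_B x)%:E = N01 B.
  move=> mB; under eq_integral do rewrite (integral_probability_cst N01).
  by rewrite integral_indic// setIT.
rewrite -(E _ mA) -(E _ mNA).
have cs : ((-1) ^+ 2 + 0 ^+ 2 = 1 :> R)%R by ring.
have f0 (p : R * R) : 0 <= (\1_A p.1)%:E :> \bar R by rewrite lee_fin.
rewrite -[RHS](@ge0_integral_normal2_rot _ (-1)%R 0%R _ cs (mI A mA) f0).
apply: eq_integral => x _; apply: eq_integral => y _.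
by rewrite /rot /= mulN1r mul0r subr0 !indicE.
Qed.

End gaussian_rotation.

(** * From plane rotations to the whole orthogonal group *)

Section orthogonal_gaussian.
Context (R : realType).

Lemma cV_consP n (x : 'cV[R]_n.+1) :
  exists (a : measurableTypeR R) (y : 'cV[R]_n), x = cons_cV (a, y).
Proof.
exists (x ord0 ord0), (dsubmx (x : 'cV_(1 + n))); rewrite cons_cVE/=.
rewrite -[LHS](@vsubmxK _ 1 n 1); congr (@col_mx _ 1 n 1 _ _).
apply/matrixP => i j; rewrite !ord1 !mxE/=; congr (x _ _).
exact/val_inj.
Qed.

Lemma cV0_cons n : cV0 R n = cons_cV (1 : measurableTypeR R, 0 : 'cV[R]_n).
Proof. by rewrite cons_cVE cV0E. Qed.

Lemma cons_cVD n (a b : measurableTypeR R) (x y : 'cV[R]_n) :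
  cons_cV (a, x) + cons_cV (b, y) = cons_cV (a + b : measurableTypeR R, x + y).
Proof. by rewrite !cons_cVE/= (@add_col_mx _ 1 n 1) raddfD. Qed.

Lemma cons_cVZ n (k : R) (a : measurableTypeR R) (x : 'cV[R]_n) :
  k *: cons_cV (a, x) = cons_cV (k * a : measurableTypeR R, k *: x).
Proof. by rewrite !cons_cVE/= (@scale_col_mx _ 1 n 1) scale_scalar_mx. Qed.

Lemma cons_cV0r n (a : measurableTypeR R) :
  cons_cV (a, 0 : 'cV[R]_n) = a *: cV0 R n.
Proof. by rewrite cV0_cons cons_cVZ mulr1 scaler0. Qed.

Lemma cons_cV00 n : cons_cV (0 : measurableTypeR R, 0 : 'cV[R]_n) = 0.
Proof. by rewrite cons_cV0r scale0r. Qed.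

Lemma givens_cV0 n c s : givens n c s *m cV0 R n.+1 =
  cons_cV (c : measurableTypeR R, cons_cV (s : measurableTypeR R, 0 : 'cV[R]_n)).
Proof.
by rewrite cV0_cons -(cons_cV00 n) givens_cons /rot /= !mulr0 !mulr1 subr0 addr0.
Qed.

Lemma mulmx_inj_col m n (A B : 'M[R]_(m, n)) :
  (forall x : 'cV[R]_n, A *m x = B *m x) -> A = B.
Proof.
move=> AB; apply/matrixP => i j.
have := AB (delta_mx j ord0); rewrite -!colE => /colP/(_ i).
by rewrite !mxE.
Qed.

Lemma orthogonal_lift_mx n (U : 'M[R]_n) :
  orthogonal_group n U -> orthogonal_group n.+1 (lift_mx U).
Proof.
rewrite /orthogonal_group/= => oU.
rewrite /lift_mx (@tr_block_mx _ 1 n 1 n) !trmx0 trmx1 (@mulmx_block _ 1 n 1 n 1 n).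
rewrite !mulmx0 !mul0mx mul1mx oU addr0 !add0r.
exact: (esym (@scalar_mx_block R 1 n 1)).
Qed.

(** The first column of [V] is the first basis vector; orthogonality against it then kills the rest
    of the first row. *)
Lemma lift_mxP n (V : 'M[R]_n.+1) :
    orthogonal_group n.+1 V -> V *m cV0 R n = cV0 R n ->
  exists2 U, orthogonal_group n U & V = lift_mx U.
Proof.
move=> oV; have VE := @submxK _ 1 n 1 n V.
rewrite -{1}VE cV0E (@mul_block_col _ 1 n 1 n 1).
rewrite !mulmx1 !mulmx0 !addr0 => /(@eq_col_mx _ 1 n 1)[ul dl].
move: oV; rewrite /orthogonal_group/= -{1 2}VE ul dl.
rewrite (@tr_block_mx _ 1 n 1 n) trmx1 trmx0 (@mulmx_block _ 1 n 1 n 1 n).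
rewrite !mul1mx !mul0mx !mulmx0 !addr0.
move=> H; have := etrans H (@scalar_mx_block R 1 n 1).
move=> /(@eq_block_mx _ 1 n 1 n)[_ ur _ dr].
exists (@drsubmx _ 1 n 1 n V).
  by move: dr; rewrite ur mulmx0 add0r.
by rewrite /lift_mx -[LHS]VE ul dl ur.
Qed.

(** The transpose is the rotation by the opposite angle, and the two rotations cancel in the first
    two coordinates. *)
Lemma orthogonal_givens n (c s : R) : c ^+ 2 + s ^+ 2 = 1 ->
  orthogonal_group n.+2 (givens n c s).
Proof.
move=> cs1.
have -> : orthogonal_group n.+2 (givens n c s) =
    (givens n c (- s) *m givens n c s = 1%:M).
  rewrite /orthogonal_group/=; congr (_ *m _ = _).
  rewrite /givens (@tr_block_mx _ 1 n.+1 1 n.+1).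
  rewrite (@tr_row_mx _ 1 1 n) (@tr_col_mx _ 1 n 1) (@tr_block_mx _ 1 n 1 n).
  by rewrite !trmx0 !tr_scalar_mx opprK.
apply: mulmx_inj_col => x; have [a [w ->]] := cV_consP x.
have [b [y ->]] := cV_consP w.
rewrite -mulmxA mul1mx !givens_cons /rot /=; congr (cons_cV (_, cons_cV (_, _))).
  by rewrite -[RHS]mul1r -cs1; ring.
by rewrite -[RHS]mul1r -cs1; ring.
Qed.

Lemma gaussian1E (A : set 'cV[R]_1) : measurable A ->
  gaussian 1 A = normal_prob 0 1 [set a : measurableTypeR R | A a%:M].
Proof.
move=> mA; rewrite gaussianSE.
have mB : measurable [set a : measurableTypeR R | A a%:M].
  apply: (measurable_set_comp _ mA); apply: measurable_mxP => i j.
  by under eq_fun do rewrite !ord1 mxE; exact: measurable_id.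
transitivity (\int[normal_prob 0 1]_a
    (\1_[set a : measurableTypeR R | A a%:M] a)%:E)%E;
  last by rewrite integral_indic// setIT.
apply: eq_integral => a _.
rewrite /= diracE indicE; congr ((nat_of_bool _)%:R%:E).
suff E : cons_cV (a, 0 : 'cV[R]_0) = a%:M by apply/idP/idP; rewrite !inE/= E.
by apply/matrixP => i j; rewrite !ord1 cons_cV0 mxE.
Qed.

Lemma gaussian_preserving_scalar1 (a : R) : a ^+ 2 = 1 ->
  gaussian_preserving (a%:M : 'M[R]_1).
Proof.
move=> a1 A mA.
have mA' := measurable_set_comp (measurable_mulmx_cst (a%:M : 'M[R]_1)) mA.
have mB : measurable [set b : measurableTypeR R | A b%:M].
  apply: (measurable_set_comp _ mA); apply: measurable_mxP => i j.
  by under eq_fun do rewrite !ord1 mxE; exact: measurable_id.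
rewrite !gaussian1E//.
have /orP[/eqP->|/eqP->] : (a == 1) || (a == - 1).
- by rewrite -eqf_sqr a1 expr1n.
- by congr (normal_prob _ _ _); apply/seteqP; split => b /=; rewrite mul1mx.
rewrite -(normal_probN mB); congr (normal_prob _ _ _).
by apply/seteqP; split => b /=; rewrite -scalar_mxM mulN1r.
Qed.

(* Such a [V] is a product of plane rotations in adjacent coordinates. *)
Lemma gaussian_preserving_transitive n (v : 'cV[R]_n.+1) : norm2 v = 1 ->
  exists V, [/\ orthogonal_group n.+1 V, gaussian_preserving V &
    V *m cV0 R n = v].
Proof.
elim: n v => [|n IHn] v v1.
  have [a va] : exists a : R, v = a%:M.
    by exists (v ord0 ord0); apply/matrixP => i j; rewrite !ord1 mxE.
  have a1 : a ^+ 2 = 1.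
    by rewrite -(expr1n _ 2) -v1 sqr_norm2 big_ord1 va mxE.
  exists a%:M; split; last by rewrite mul_scalar_mx va; apply/matrixP => i j;
    rewrite !ord1 !mxE/= mulr1.
    by rewrite /orthogonal_group/= tr_scalar_mx -scalar_mxM -expr2 a1.
  exact: gaussian_preserving_scalar1.
have [a [w vE]] := cV_consP v.
have as1 : a ^+ 2 + norm2 w ^+ 2 = 1.
  by rewrite -sqr_norm2_col_mx -[RHS](expr1n _ 2) -v1 vE cons_cVE.
(* The vector [w'] is the direction of [w]; any unit vector serves when [w = 0]. *)
have [w' w'1 wE] : exists2 w', norm2 w' = 1 & w = norm2 w *: w'.
  have [w0|w0] := eqVneq w 0.
    exists (cV0 R n); first exact: norm2_cV0.
    by rewrite w0 (eqP (_ : norm2 0 == 0)) ?scale0r// norm2_eq0.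
  have nw0 : norm2 w != 0 by rewrite norm2_eq0.
  exists ((norm2 w)^-1 *: w); last by rewrite scalerA divff// scale1r.
  by rewrite norm2Z ger0_norm ?invr_ge0 ?norm2_ge0// mulVf.
have [V [oV pV V0]] := IHn w' w'1.
(* The plane rotation sends the first basis vector to [(a, norm2 w, 0)]; the lift of [V] then turns
   [norm2 w] times the first basis vector of the smaller space into [norm2 w *: w' = w]. *)
exists (lift_mx V *m givens n a (norm2 w)); split.
- by apply: orthogonal_mul; [exact: orthogonal_lift_mx|exact: orthogonal_givens].
- apply: gaussian_preserving_mul; first exact: gaussian_preserving_lift.
  exact: gaussian_preserving_givens.
by rewrite -mulmxA givens_cV0 lift_mx_cons cons_cV0r -scalemxAr V0 -wE.
Qed.

(** Induction on [n]: choose an invariance-preserving orthogonal [V] that agrees with [U] on the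
    first basis vector. Then [V^T *m U] fixes that vector, hence is the lift of a smaller orthogonal
    matrix. *)
Lemma gaussian_orthogonal n (U : 'M[R]_n) :
  orthogonal_group n U -> gaussian_preserving U.
Proof.
elim: n U => [|n IHn] U oU.
  have -> : U = 1%:M by apply/matrixP => -[].
  exact: gaussian_preserving1.
have [V [oV pV V0]] : exists V, [/\ orthogonal_group n.+1 V,
    gaussian_preserving V & V *m cV0 R n = U *m cV0 R n].
  by apply: gaussian_preserving_transitive; rewrite norm2_orthogonal// norm2_cV0.
have [W oW WE] : exists2 W, orthogonal_group n W & V^T *m U = lift_mx W.
  apply: lift_mxP; first exact: orthogonal_mul (orthogonal_tr oV) oU.
  by rewrite -mulmxA -V0 mulmxA oV mul1mx.
have -> : U = V *m lift_mx W by rewrite -WE mulmxA orthogonalP// mul1mx.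
by apply: gaussian_preserving_mul => //; exact/gaussian_preserving_lift/IHn.
Qed.

(** Both vectors are images of the same multiple of the first basis vector; the inverse of one
    orthogonal matrix is composed with the other. *)
Lemma orthogonal_transitive n (x y : 'cV[R]_n) : norm2 x = norm2 y ->
  exists2 V, orthogonal_group n V & V *m x = y.
Proof.
case: n x y => [|n] x y xy.
  by exists 1%:M; [exact: orthogonal1|apply/matrixP => -[]].
have [y0|y0] := eqVneq y 0.
  move: xy; rewrite y0 (eqP (_ : norm2 0 == 0)) ?norm2_eq0// => /eqP.
  by rewrite norm2_eq0 => /eqP->; exists 1%:M; [exact: orthogonal1|rewrite mul1mx].
have unit (z : 'cV[R]_n.+1) : z != 0 ->
    exists2 V, orthogonal_group n.+1 V & V *m (norm2 z *: cV0 R n) = z.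
  move=> z0; have nz0 : norm2 z != 0 by rewrite norm2_eq0.
  have [|V [oV _ V0]] := @gaussian_preserving_transitive n ((norm2 z)^-1 *: z).
    by rewrite norm2Z ger0_norm ?invr_ge0 ?norm2_ge0// mulVf.
  by exists V => //; rewrite -scalemxAr V0 scalerA divff// scale1r.
have x0 : x != 0 by rewrite -norm2_eq0 xy norm2_eq0.
have [V oV Vy] := unit y y0; have [W oW Wx] := unit x x0.
exists (V *m W^T); first exact: orthogonal_mul oV (orthogonal_tr oW).
by rewrite -Wx mulmxA -(mulmxA V) oW mulmx1 xy Vy.
Qed.

End orthogonal_gaussian.

(** * The Haar measure of the orthogonal group *)

Section fubini_sets.
Local Open Scope ereal_scope.
Context d1 d2 (T1 : measurableType d1) (T2 : measurableType d2) (R : realType).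
Variables (P1 : {sigma_finite_measure set T1 -> \bar R}).
Variables (P2 : {sigma_finite_measure set T2 -> \bar R}).

Lemma measurable_fun_section (A : T1 -> T2 -> Prop) :
  measurable [set p | A p.1 p.2] ->
  measurable_fun setT (fun x => P2 [set y | A x y]).
Proof.
move=> mA; have := measurable_fun_xsection P2 mA.
apply: eq_measurable_fun => x _ /=; congr (P2 _).
by apply/seteqP; split => y /=; rewrite /xsection/= inE.
Qed.

Lemma fubini_sections (A : T1 -> T2 -> Prop) :
  measurable [set p | A p.1 p.2] ->
  \int[P1]_x P2 [set y | A x y] = \int[P2]_y P1 [set x | A x y].
Proof.
move=> mA; have := indic_fubini_tonelli P1 P2 mA.
rewrite indic_fubini_tonelli_FE// indic_fubini_tonelli_GE// => H.
transitivity (\int[P1]_x (P2 \o xsection [set p | A p.1 p.2]) x).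
  apply: eq_integral => x _ /=; congr (P2 _).
  by apply/seteqP; split => y /=; rewrite /xsection/= inE.
rewrite H; apply: eq_integral => y _ /=; congr (P1 _).
by apply/seteqP; split => x /=; rewrite /ysection/= inE.
Qed.

End fubini_sets.

Section haar.
Local Open Scope ereal_scope.
Context (R : realType) (n : nat) (nu : probability 'M[R]_n R).
Hypothesis hnu : is_haar_orthogonal nu.

Lemma measurable_orthogonal_group : measurable (orthogonal_group n : set 'M[R]_n).
Proof.
rewrite (_ : orthogonal_group n = \bigcap_(ij in [set: 'I_n * 'I_n])
    [set U : 'M[R]_n | (U^T *m U) ij.1 ij.2 = (1%:M : 'M[R]_n) ij.1 ij.2]);
  last first.
  apply/seteqP; split=> [U oU [i j] _ /=|U UE]; first by rewrite oU.
  by apply/matrixP => i j; exact: (UE (i, j)).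
apply: fin_bigcap_measurable => [|[i j] _]; first exact: finite_finset.
apply: (@measurable_set_comp _ _ _ _ (fun U : 'M[R]_n => (U^T *m U) i j)
  [set (1%:M : 'M[R]_n) i j]); last exact: measurable_set1.
apply: (measurableT_comp (measurable_mx_coord i j)).
by apply: measurable_mulmx => //; exact: measurable_trmx.
Qed.

Lemma haar_setC : nu (~` orthogonal_group n) = 0.
Proof.
rewrite probability_setC; last exact: measurable_orthogonal_group.
by rewrite hnu.1 subee.
Qed.

(** The measure [nu] lives on all square matrices but gives full mass to the orthogonal group, so
    only the values there count. *)
Lemma haar_integral_cst (f : 'M[R]_n -> \bar R) c :
    measurable_fun setT f -> (forall U, orthogonal_group n U -> f U = c) ->
  \int[nu]_U f U = c.
Proof.
move=> mf fc; rewrite -[RHS](integral_probability_cst nu).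
apply: ae_eq_integral => //.
exists (~` orthogonal_group n); split.
- exact: measurableC measurable_orthogonal_group.
- exact: haar_setC.
- by move=> U /= nU oU; apply: nU => _; exact: fc.
Qed.

Lemma haarL (V : 'M[R]_n) A : orthogonal_group n V -> measurable A ->
  nu [set U | A (V *m U)] = nu A.
Proof.
move=> oV mA; rewrite -(hnu.2 _ _ (orthogonal_tr oV) mA); congr (nu _).
apply/seteqP; split => [U AU|U /= [W AW <-]].
  by exists (V *m U) => //; rewrite mulmxA oV mul1mx.
by rewrite mulmxA orthogonalP// mul1mx.
Qed.

Let measurable_trmul : measurable_fun setT (fun p : 'M[R]_n * 'M[R]_n => p.1^T *m p.2).
Proof. by apply: measurable_mulmx => //; exact: measurable_trmx. Qed.

(** Take [W] and [U] independent and compute the probability of [A (W^T *m U)] in two ways. For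
    fixed [W], left invariance gives [nu A]; for fixed [U], writing [W^T *m U] as the transpose of
    [U^T *m W] gives the measure of the transposed set. *)
Lemma haar_tr (A : set 'M[R]_n) : measurable A -> nu [set U | A U^T] = nu A.
Proof.
move=> mA.
have mA' : measurable [set M : 'M[R]_n | A M^T].
  by apply: measurable_set_comp mA; exact: measurable_trmx.
have mP := measurable_set_comp measurable_trmul mA.
have := fubini_sections nu nu (A := fun W U => A (W^T *m U)) mP.
rewrite (@haar_integral_cst _ (nu A)); last 2 first.
- exact: (measurable_fun_section nu (A := fun W U => A (W^T *m U)) mP).
- by move=> W /orthogonal_tr oW; exact: haarL.
rewrite (@haar_integral_cst _ (nu [set M : 'M[R]_n | A M^T])) => [->//||].
  have mP' : measurable [set p : 'M[R]_n * 'M[R]_n | A (p.2^T *m p.1)].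
    apply: measurable_set_comp mA.
    by apply: measurable_mulmx => //; exact: measurable_trmx.
  exact: (measurable_fun_section nu (A := fun U W => A (W^T *m U)) mP').
move=> U /orthogonal_tr oU; rewrite -(haarL oU mA'); congr (nu _).
by apply/seteqP; split => W /=; rewrite trmx_mul trmxK.
Qed.

(** Left invariance conjugated by transposition. *)
Lemma haarR (V : 'M[R]_n) A : orthogonal_group n V -> measurable A ->
  nu [set U | A (U *m V)] = nu A.
Proof.
move=> oV mA.
have mA' : measurable [set M : 'M[R]_n | A M^T].
  by apply: measurable_set_comp mA; exact: measurable_trmx.
rewrite -(haar_tr mA) -(haarL (orthogonal_tr oV) mA') -(@haar_tr [set U | A (U *m V)]).
  by congr (nu _); apply/seteqP; split => U /=; rewrite trmx_mul trmxK.
apply: measurable_set_comp mA; apply: measurable_mulmx => //; exact: measurable_cst.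
Qed.

Section orbit.
Variables (K : set 'cV[R]_n) (mK : measurable K).

Lemma measurable_orbit (x : 'cV[R]_n) : measurable [set U : 'M[R]_n | K (U *m x)].
Proof.
by apply: measurable_set_comp mK; apply: measurable_mulmx => //; exact: measurable_cst.
Qed.

(** An orthogonal matrix carries [x] to [y], and right invariance absorbs it: the proportion depends
    only on the norm. *)
Lemma haar_orbit (x y : 'cV[R]_n) : norm2 x = norm2 y ->
  nu [set U | K (U *m x)] = nu [set U | K (U *m y)].
Proof.
move=> /orthogonal_transitive[V oV <-].
rewrite -(haarR oV (measurable_orbit x)); congr (nu _).
by apply/seteqP; split => U /=; rewrite mulmxA.
Qed.

(** One may replace [x] by the multiple of [y] of the same norm; as [K] is star-shaped, [U *m y] in
    [K] then forces the shorter vector into [K]. *)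
Lemma haar_orbit_le (x y : 'cV[R]_n) :
    (forall a z, (0 <= a <= 1)%R -> K z -> K (a *: z)) ->
    (norm2 x <= norm2 y)%R ->
  nu [set U | K (U *m y)] <= nu [set U | K (U *m x)].
Proof.
move=> starK xy; have [y0|y0] := eqVneq (norm2 y) 0%R.
  rewrite (haar_orbit (x := x) (y := y))//.
  by apply/eqP; rewrite eq_le xy y0 norm2_ge0.
have y_gt0 : (0 < norm2 y)%R by rewrite lt_def y0 norm2_ge0.
rewrite (@haar_orbit x ((norm2 x / norm2 y) *: y)); last first.
  by rewrite norm2Z ger0_norm ?divr_ge0 ?norm2_ge0// divfK.
apply: le_measure; rewrite ?inE; [exact: measurable_orbit..|].
move=> U /= KUy; rewrite -scalemxAr; apply: starK => //.
by rewrite divr_ge0 ?norm2_ge0//= ler_pdivrMr// mul1r.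
Qed.

(** This is the substitute for polar coordinates: in the double integral over [x] and [U],
    integrating in [x] first gives [gaussian n K] for every orthogonal [U]. *)
Lemma gaussian_haar :
  gaussian n K = \int[gaussian n]_x nu [set U | K (U *m x)].
Proof.
have mP : measurable [set p : 'cV[R]_n * 'M[R]_n | K (p.2 *m p.1)].
  by apply: measurable_set_comp mK; exact: measurable_mulmx.
have mP' : measurable [set p : 'M[R]_n * 'cV[R]_n | K (p.1 *m p.2)].
  by apply: measurable_set_comp mK; exact: measurable_mulmx.
rewrite (fubini_sections (gaussian n) nu (A := fun x U => K (U *m x)) mP).
rewrite (@haar_integral_cst _ (gaussian n K))//.
  exact: (measurable_fun_section (gaussian n) (A := fun U x => K (U *m x)) mP').
by move=> U oU; exact: gaussian_orthogonal.
Qed.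

Lemma measurable_pair_orbit (x : 'cV[R]_n) : measurable
  [set p : 'M[R]_n * 'M[R]_n | K (p.2 *m x) /\ K (p.2 *m (p.1 *m x))].
Proof.
apply: measurableI; apply: measurable_set_comp mK.
  by apply: measurable_mulmx => //; exact: measurable_cst.
apply: measurable_mulmx => //; apply: measurable_mulmx => //; exact: measurable_cst.
Qed.

(** For fixed orthogonal [U], the product [U *m W] is again Haar distributed, so the two events are
    independent when [W] and [U] are. *)
Lemma haar_pair_orbit (x : 'cV[R]_n) :
  \int[nu]_W nu [set U | K (U *m x) /\ K (U *m (W *m x))] =
  nu [set U | K (U *m x)] * nu [set U | K (U *m x)].
Proof.
rewrite (fubini_sections nu nu (measurable_pair_orbit x)).
have mx := measurable_orbit x.
transitivity (\int[nu]_U ((\1_[set U | K (U *m x)] U)%:E *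
    nu [set W | K (W *m x)])); last first.
  by rewrite ge0_integralZr// ?integral_indic ?setIT//; exact/measurable_EFinP.
have mg : measurable_fun setT (fun U => nu [set W | K (U *m x) /\ K (U *m (W *m x))]).
  apply: (measurable_fun_section nu (A := fun U W => K (U *m x) /\ K (U *m (W *m x)))).
  apply: measurableI; apply: measurable_set_comp mK.
    by apply: measurable_mulmx => //; exact: measurable_cst.
  apply: measurable_mulmx => //; apply: measurable_mulmx => //; exact: measurable_cst.
apply: ae_eq_integral => //.
  by apply: emeasurable_funM => //; exact/measurable_EFinP.
exists (~` orthogonal_group n); split.
- exact: measurableC measurable_orthogonal_group.
- exact: haar_setC.
move=> U /= nU oU; apply: nU => _; rewrite indicE.
have [KUx|KUx] := pselect (K (U *m x)).
  rewrite mem_set// mul1e -(haarL oU mx); congr (nu _).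
  by apply/seteqP; split => W /=; rewrite mulmxA => // -[].
rewrite memNset// mul0e (_ : [set _ | _] = set0) ?measure0//.
by apply/seteqP; split => W // [].
Qed.

End orbit.

End haar.

(** * Sections by planes *)

Section half_circle.
Context (R : realType).
Notation mu := (@lebesgue_measure R).
Implicit Types (A B : set R) (x y : R).

Let periodic A := forall x, A (x + pi) <-> A x.

(** The piece of the arc beyond [pi] is translated back by [pi] onto the missing initial piece. *)
Lemma periodic_arc A x : measurable A -> periodic A -> 0 <= x <= pi ->
  mu (A `&` `[x, x + pi[) = mu (A `&` `[0%R, pi[).
Proof.
move=> mA pA /andP[x0 xpi].
have mI a b : measurable (A `&` `[a, b[) by exact: measurableI.
have split3 a b c : a <= b -> b <= c ->
    mu (A `&` `[a, c[) = (mu (A `&` `[a, b[) + mu (A `&` `[b, c[))%E.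
  move=> ab bc; rewrite -measureU; [|exact: mI|exact: mI|].
    rewrite -setIUr; congr (mu (_ `&` _)); apply/seteqP; split => z /=.
      rewrite !in_itv/= => /andP[az zc]; have [zb|bz] := ltP z b.
        by left; rewrite az.
      by right.
    rewrite !in_itv/= => -[/andP[az zb]|/andP[bz zc]].
      by rewrite az (lt_le_trans zb).
    by rewrite (le_trans ab).
  apply/seteqP; split => // z [[_ /=]]; rewrite in_itv/= => /andP[_ zb] [_ /=].
  by rewrite in_itv/= => /andP[bz _]; move: (lt_le_trans zb bz); rewrite ltxx.
rewrite (@split3 x pi)//; last by rewrite lerDr.
rewrite (@split3 0 x)// addeC; congr (_ + _)%E.
rewrite -(@lebesgue_measureD _ pi (A `&` `[pi, x + pi[)); last exact: mI.
congr (mu _); apply/seteqP; split => z /= [Az]; rewrite !in_itv/=.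
  by move=> /andP[z1 z2]; split; [exact/pA|lra].
by move=> /andP[z1 z2]; split; [exact/pA|lra].
Qed.

(* [B] contains the arcs by which the hull of [A] in a half circle is to be
   prolonged on either side, but in general not the whole hull. *)
Lemma arc_growth A B : closed A -> measurable B -> periodic A -> periodic B ->
    A `<=` B ->
    (forall a b x, A a -> A b -> a <= b -> b <= x -> x <= b + (b - a) / 4 ->
      x <= a + pi -> B x) ->
    (forall a b x, A a -> A b -> a <= b -> x <= a -> a - (b - a) / 4 <= x ->
      b - pi <= x -> B x) ->
  `[0%R, pi[ `<=` B \/
  ((3 / 2)%:E * mu (A `&` `[0%R, pi[) <= mu (B `&` `[0%R, pi[))%E.
Proof.
move=> cA mB pA pB AB ext1 ext2.
have mA : measurable A by exact: closed_measurable.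
have [IB|/existsNP[x0 /not_implyP[]]] := pselect (`[0%R, pi[ `<=` B); [by left|].
(* The circle is cut at a point [x0] outside [B], hence outside [A]. The half circle from [x0] to
   [x0 + pi] then has both ends off [A]. *)
rewrite /= in_itv/= => /andP[x0_ge0 x0_lt] nBx0; right.
have x0I : 0 <= x0 <= pi by rewrite x0_ge0 ltW.
rewrite -(periodic_arc mA pA x0I) -(periodic_arc mB pB x0I).
have nAx0 : ~ A x0 by move=> /AB.
have nAx1 : ~ A (x0 + pi) by move=> /pA.
pose M := A `&` `[x0, x0 + pi].
have [M0|/set0P M0] := eqVneq M set0.
  rewrite (_ : A `&` `[x0, x0 + pi[ = set0) ?measure0 ?mule0//.
  rewrite -subset0 -M0 => z [Az /=]; rewrite in_itv/= => /andP[z1 z2].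
  by split => //=; rewrite in_itv/= z1 ltW.
have cM : compact M.
  apply: (subclosed_compact _ (@segment_compact _ x0 (x0 + pi))).
    by apply: closedI => //; exact: itv_closed.
  by move=> z [].
have cid : {within M, continuous (@idfun R)}.
  by apply: continuous_subspaceT => z; exact: cvg_id.
(* The points [a] and [b] are the extreme points of [A] in this half circle. *)
have [b /set_mem[Ab /=]] := compact_EVT_max M0 cM cid.
rewrite in_itv/= => /andP[x0b bx1] bmax.
have [a /set_mem[Aa /=]] := compact_EVT_min M0 cM cid.
rewrite in_itv/= => /andP[x0a ax1] amin.
have Mab z : A z -> x0 <= z < x0 + pi -> a <= z <= b.
  move=> Az /andP[z1 z2]; have Mz : M z by split => //=; rewrite in_itv/= z1 ltW.
  by rewrite amin ?bmax ?inE.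
have ab : a <= b by apply: amin; rewrite inE; split => //=; rewrite in_itv/= x0b.
have {x0a} x0a : x0 < a.
  by rewrite lt_neqAle x0a andbT; apply/eqP => ax0; apply: nAx0; rewrite ax0.
have {bx1} bx1 : b < x0 + pi.
  by rewrite lt_neqAle bx1 andbT; apply/eqP => bx; apply: nAx1; rewrite -bx.
(* A prolongation reaching [x0 + pi] would put that point in [B], and by periodicity [x0] too. Hence
   both prolongations stay inside the half circle. *)
have hi : b + (b - a) / 4 < x0 + pi.
  rewrite ltNge; apply/negP => H; apply/nBx0/pB.
  by apply: (ext1 a b) => //; lra.
have lo : x0 < a - (b - a) / 4.
  rewrite ltNge; apply/negP => H; apply/nBx0.
  by apply: (ext2 a b) => //; lra.
pose J1 := `]b, b + (b - a) / 4]%classic : set R.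
pose J2 := `[a - (b - a) / 4, a[%classic : set R.
pose W := A `&` `[x0, x0 + pi[.
have mW : measurable W by exact: measurableI.
have mJ1 : measurable J1 by exact: measurable_itv.
have mJ2 : measurable J2 by exact: measurable_itv.
have mWJ1 : measurable (W `|` J1) by exact: measurableU.
have muJ1 : mu J1 = ((b - a) / 4)%:E.
  rewrite /J1 lebesgue_measure_itv/= lte_fin; case: ifPn.
    by move=> _; rewrite -EFinB; congr EFin; lra.
  by rewrite -leNgt => H; congr EFin; lra.
have muJ2 : mu J2 = ((b - a) / 4)%:E.
  rewrite /J2 lebesgue_measure_itv/= lte_fin; case: ifPn.
    by move=> _; rewrite -EFinB; congr EFin; lra.
  by rewrite -leNgt => H; congr EFin; lra.
(* The measure of [A] is at most [b - a], while [J1] and [J2] add [(b - a) / 2] in total: this is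
   the source of the factor [3 / 2]. *)
have muW : (mu W <= (b - a)%:E)%E.
  have -> : (b - a)%:E = mu `[a, b].
    rewrite lebesgue_measure_itv/= lte_fin EFinB; case: ifPn => //.
    by rewrite -leNgt => H; rewrite -EFinB; congr EFin; lra.
  apply: le_measure; rewrite ?inE//= => z [Az /=]; rewrite !in_itv/=.
  exact: Mab.
have : (mu (W `|` J1 `|` J2) <= mu (B `&` `[x0, (x0 + pi)%R[))%E.
  apply: le_measure; rewrite ?inE.
  - exact: measurableU.
  - exact: measurableI.
  - move=> z [[[Az zI]|]|]; first by split => //; exact: AB.
      rewrite /J1/= !in_itv/= => /andP[bz zb]; split.
        by apply: (ext1 a b) => //; lra.
      by lra.
    rewrite /J2/= !in_itv/= => /andP[az za]; split.
      by apply: (ext2 a b) => //; lra.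
    by lra.
have d1 : W `&` J1 = set0.
  apply/seteqP; split => // z [[Az zI]]; rewrite /J1/= in_itv/=.
  by have := Mab _ Az; move: zI; rewrite /= in_itv/= => -> /(_ isT); lra.
have d2 : (W `|` J1) `&` J2 = set0.
  apply/seteqP; split => // z [[[Az zI]|]]; rewrite /J1 /J2/= !in_itv/=; last by lra.
  by have := Mab _ Az; move: zI; rewrite /= in_itv/= => -> /(_ isT); lra.
have -> : mu (W `|` J1 `|` J2) = (mu W + ((b - a) / 4)%:E + ((b - a) / 4)%:E)%E.
  transitivity (mu (W `|` J1) + mu J2)%E; first exact: measureU.
  rewrite muJ2; congr (_ + _)%E; transitivity (mu W + mu J1)%E; last by rewrite muJ1.
  exact: measureU.
apply: le_trans.
have W0 : (0 <= mu W)%E by exact: measure_ge0.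
rewrite -/W; move: W0 muW; case: (mu W) => [w| |]//; rewrite !lee_fin => w0 wb.
lra.
Qed.

(** Inclusion-exclusion: [A] and its translate have the same measure, and their union fits in an
    interval of length [pi]. *)
Lemma arc_overlap A y : measurable A -> periodic A -> 0 <= y <= pi ->
  (mu (A `&` `[0%R, pi[) + mu (A `&` `[0%R, pi[) <=
   pi%:E + mu ([set x | A x /\ A (x + y)%R] `&` `[0%R, pi[))%E.
Proof.
move=> mA pA y0pi; pose A' := [set x | A (x + y)%R].
have mA' : measurable A' by exact: (measurable_set_comp (measurable_addr y) mA).
have E : mu (A' `&` `[0%R, pi[) = mu (A `&` `[0%R, pi[).
  rewrite -(periodic_arc mA pA y0pi).
  rewrite -(@lebesgue_measureD _ y (A `&` `[y, y + pi[)); last exact: measurableI.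
  congr (mu _); apply/seteqP; split => z /= [Az]; rewrite !in_itv/= => H.
    by split => //; lra.
  by split => //; lra.
have piE : mu `[0%R, pi[ = pi%:E.
  by rewrite lebesgue_measure_itv/= lte_fin pi_gt0 sube0.
have fin C : measurable C -> (mu (C `&` `[0%R, pi[) < +oo)%E.
  move=> mC; apply: (@le_lt_trans _ _ (mu `[0%R, pi[)); last by rewrite piE ltry.
  by apply: le_measure; rewrite ?inE//; exact: measurableI.
have : mu ((A `&` `[0%R, pi[) `|` (A' `&` `[0%R, pi[)) =
    (mu (A `&` `[0%R, pi[) + mu (A' `&` `[0%R, pi[) -
     mu ((A `&` `[0%R, pi[) `&` (A' `&` `[0%R, pi[)))%E.
  by apply: measureUfinr; [exact: measurableI|exact: measurableI|exact: fin].
rewrite E -setIUl setIACA setIid.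
have : (mu ((A `|` A') `&` `[0%R, pi[) <= pi%:E)%E.
  rewrite -piE; apply: le_measure; rewrite ?inE//.
  by apply: measurableI => //; exact: measurableU.
have := fin _ mA; have := fin _ (measurableI _ _ mA mA').
rewrite (_ : [set x | _] = A `&` A')//.
have : (0 <= mu (A `&` `[0%R, pi[))%E by exact: measure_ge0.
have : (0 <= mu (A `&` A' `&` `[0%R, pi[))%E by exact: measure_ge0.
case: (mu (A `&` `[0%R, pi[)) => [a| |]//; case: (mu (A `&` A' `&` _)) => [w| |]//.
move=> _ _ _ _ H1 H2; move: H1; rewrite H2 -!EFinD !lee_fin; lra.
Qed.

(** If [B] does not fill the half circle, growth alone suffices. Otherwise its measure is [pi], and
    averaging [|A| <= pi] with [2 |A| <= pi + w], where [w] is the overlap, gives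
    [3 / 2 |A| <= pi + w / 2]. *)
Lemma arc_growth_overlap A B y : closed A -> measurable B ->
    periodic A -> periodic B -> A `<=` B ->
    (forall a b x, A a -> A b -> a <= b -> b <= x -> x <= b + (b - a) / 4 ->
      x <= a + pi -> B x) ->
    (forall a b x, A a -> A b -> a <= b -> x <= a -> a - (b - a) / 4 <= x ->
      b - pi <= x -> B x) ->
    0 <= y <= pi ->
  ((3 / 2)%:E * mu (A `&` `[0%R, pi[) <= mu (B `&` `[0%R, pi[) +
    (1 / 2)%:E * mu ([set x | A x /\ A (x + y)%R] `&` `[0%R, pi[))%E.
Proof.
move=> cA mB pA pB AB ext1 ext2 y0pi.
have mA : measurable A by exact: closed_measurable.
have [IB|H] := arc_growth cA mB pA pB AB ext1 ext2; last first.
  by apply: (le_trans H); rewrite leeDl// mule_ge0// lee_fin; lra.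
have piE : mu `[0%R, pi[ = pi%:E.
  by rewrite lebesgue_measure_itv/= lte_fin pi_gt0 sube0.
rewrite (setIidr IB) piE.
have Api : (mu (A `&` `[0%R, pi[) <= pi%:E)%E.
  by rewrite -piE; apply: le_measure; rewrite ?inE//; exact: measurableI.
have := arc_overlap mA pA y0pi; move: Api.
have : (0 <= mu (A `&` `[0%R, pi[))%E by exact: measure_ge0.
have : (0 <= mu ([set x | A x /\ A (x + y)%R] `&` `[0%R, pi[))%E.
  exact: measure_ge0.
case: (mu (A `&` `[0%R, pi[)) => [a| |]//.
case: (mu ([set x | A x /\ A (x + y)%R] `&` _)) => [w| |]//.
  by rewrite -!EFinM -!EFinD !lee_fin; lra.
by move=> *; rewrite gt0_muley ?lte_fin ?divr_gt0//= leey.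
Qed.

End half_circle.

(** * Symmetric convex sets on a circle and on the circle shrunk by [2 / 3] *)

Section plane_section.
Context (R : realType).
Notation mu := (@lebesgue_measure R).

(** In [sin y cos z + cos y sin z], the first term is at most [sin y] and the second at most
    [cos (y / 2) sin (y / 2)], which is half of [sin y]. *)
Lemma sin_le_three_halves (y z : R) : 0 <= y <= pi / 2 -> 0 <= z <= y / 2 ->
  sin (y + z) <= 3 / 2 * sin y.
Proof.
move=> /andP[y0 ypi] /andP[z0 zy].
have yE : y = (y / 2) *+ 2 by rewrite mulr2n; lra.
have cy2 : 0 <= cos (y / 2) by apply: cos_ge0_pihalf; lra.
have cy : 0 <= cos y by apply: cos_ge0_pihalf; lra.
have sy2 : 0 <= sin (y / 2) by apply: sin_ge0_pi; lra.
have sz : 0 <= sin z by apply: sin_ge0_pi; lra.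
have szy : sin z <= sin (y / 2).
  by rewrite leNgt ltr_sin ?in_itv/= -?leNgt//; lra.
have syE : sin y = 2 * (cos (y / 2) * sin (y / 2)).
  by rewrite {1}yE sin_mulr2n mulr2n; ring.
have cyE : cos y = 2 * cos (y / 2) ^+ 2 - 1.
  by rewrite {1}yE cos_mulr2n mulr2n; ring.
have c1 : cos (y / 2) <= 1 by exact: cos_le1.
have cyc : cos y <= cos (y / 2) by rewrite cyE; nra.
have cz1 : cos z <= 1 by exact: cos_le1.
have sy : 0 <= sin y by rewrite syE; nra.
have h1 : sin y * cos z <= sin y by rewrite ler_piMr.
have h2 : cos y * sin z <= cos (y / 2) * sin (y / 2) by apply: ler_pM.
by rewrite sinD; lra.
Qed.

(** A centred ellipse in general, and a circle when [p] and [q] are orthogonal of equal norm. *)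
Definition circ n (p q : 'cV[R]_n) (x : R) : 'cV[R]_n := cos x *: p + sin x *: q.

Lemma circDpi n (p q : 'cV[R]_n) x : circ p q (x + pi) = - circ p q x.
Proof. by rewrite /circ cosDpi sinDpi !scaleNr opprD. Qed.

Lemma circN n (p q : 'cV[R]_n) x : circ p (- q) (- x) = circ p q x.
Proof. by rewrite /circ cosN sinN scaleNr scalerN opprK. Qed.

Lemma circ_scale n a (p q : 'cV[R]_n) x : circ (a *: p) (a *: q) x = a *: circ p q x.
Proof. by rewrite /circ scalerDr !scalerA !(mulrC a). Qed.

Lemma mulmx_circ m n (U : 'M[R]_(m, n)) p q x :
  U *m circ p q x = circ (U *m p) (U *m q) x.
Proof. by rewrite /circ mulmxDr -!scalemxAr. Qed.

(** The linear relation between three points of the curve; it expresses the point at [x] through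
    those at [a] and [b]. *)
Lemma circ_comb n (p q : 'cV[R]_n) a b x : sin (b - a) *: circ p q x =
  sin (x - a) *: circ p q b - sin (x - b) *: circ p q a.
Proof.
rewrite /circ; apply/colP => i; rewrite !mxE !sinB; ring.
Qed.

Lemma continuous_circ n (p q : 'cV[R]_n.+1) : continuous (circ p q).
Proof.
move=> x; apply: cvgD; apply: cvgZr_tmp.
  exact: continuous_cos.
exact: continuous_sin.
Qed.

Section body.
Variables (n : nat) (K : set 'cV[R]_n.+1).
Hypothesis cK : closed K.
Hypothesis KC : forall a b u v, K u -> K v -> `|a| + `|b| <= 1 ->
  K (a *: u + b *: v).

Let KN u : K u -> K (- u).
Proof.
move=> Ku; have := @KC (-1) 0 u u Ku Ku.
by rewrite normrN1 normr0 addr0 scaleN1r scale0r addr0; apply.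
Qed.

(** The point at [x] is a combination of those at [a] and [b] whose coefficients have absolute sum
    [(sin (x - a) + sin (x - b)) / sin (b - a)]. This is at most [3 / 2], so the factor [2 / 3]
    brings the point back into [K]. *)
Lemma circ_extension p q a b x : K (circ p q a) -> K (circ p q b) ->
    a <= b -> b <= x -> x <= b + (b - a) / 4 -> x <= a + pi ->
  K ((2 / 3) *: circ p q x).
Proof.
move=> Ka Kb ab bx xb xa.
have shrink u : K u -> K ((2 / 3) *: u).
  move=> Ku; have := @KC (2 / 3) 0 u u Ku Ku; rewrite scale0r addr0; apply.
  by rewrite normr0 addr0 ger0_norm; lra.
have [ab0|ab'] := eqVneq a b.
  have -> : x = a by lra.
  exact: shrink.
have [xb'|xb'] := eqVneq x b; first by rewrite xb'; exact: shrink.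
(* If [b - a = pi], then [x <= a + pi = b] forces [x = b], already settled; so the denominator
   [sin (b - a)] is positive. *)
have bapi : 0 < b - a < pi.
  rewrite subr_gt0 lt_neqAle ab' ab/= lt_neqAle; apply/andP; split; last by lra.
  by apply/eqP => bapi; move/eqP: xb'; apply; lra.
have s0 : 0 < sin (b - a) by exact: sin_gt0_pi.
have XE : circ p q x = (sin (x - a) / sin (b - a)) *: circ p q b
    - (sin (x - b) / sin (b - a)) *: circ p q a.
  apply: (scalerI (lt0r_neq0 s0)); rewrite circ_comb scalerBr !scalerA.
  by rewrite !(mulrC (sin (b - a))) !divfK ?lt0r_neq0.
have s1 : 0 <= sin (x - a) by apply: sin_ge0_pi; lra.
have s2 : 0 <= sin (x - b) by apply: sin_ge0_pi; lra.
(* With [y] half of [b - a] and [z = x - b], the left side is [2 sin (y + z) cos y] and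
   [sin (b - a)] is [2 sin y cos y], so it suffices to compare [sin (y + z)] with [sin y]. *)
have sum_le : sin (x - a) + sin (x - b) <= 3 / 2 * sin (b - a).
  have [y yE] : exists y, y = (b - a) / 2 by eexists.
  have [z zE] : exists z, z = x - b by eexists.
  have cy : 0 <= cos y by apply: cos_ge0_pihalf; lra.
  have sy : sin (y + z) <= 3 / 2 * sin y by apply: sin_le_three_halves; lra.
  have -> : x - a = (y + z) + y by lra.
  have -> : sin (x - b) = sin ((y + z) - y) by congr sin; lra.
  have -> : b - a = y + y by lra.
  by rewrite (sinB (y + z)) (sinD (y + z)) (sinD y y); nra.
rewrite XE scalerBr !scalerA -scaleNr; apply: KC => //.
rewrite normrN !ger0_norm ?mulr_ge0 ?invr_ge0 ?(ltW s0)//.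
by rewrite -mulrDr -mulrDl mulrA ler_pdivrMr// mul1r; lra.
Qed.

(** The reflection [x] to [- x], with [q] replaced by [- q], exchanges the two sides. *)
Lemma circ_extension_left p q a b x : K (circ p q a) -> K (circ p q b) ->
    a <= b -> x <= a -> a - (b - a) / 4 <= x -> b - pi <= x ->
  K ((2 / 3) *: circ p q x).
Proof.
rewrite -(circN p q a) -(circN p q b) -(circN p q x) => Ka Kb ab xa ax bx.
by apply: circ_extension Kb Ka _ _ _ _; lra.
Qed.

Lemma closed_circ p q : closed [set x | K (circ p q x)].
Proof.
apply: (closed_comp (f := circ p q)) => // x _; exact: continuous_circ.
Qed.

Lemma circ_growth p q y : 0 <= y <= pi ->
  ((3 / 2)%:E * mu ([set x | K (circ p q x)] `&` `[0%R, pi[) <=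
   mu ([set x | K ((2 / 3)%R *: circ p q x)] `&` `[0%R, pi[) +
   (1 / 2)%:E * mu ([set x | K (circ p q x) /\ K (circ p q (x + y)%R)]
     `&` `[0%R, pi[))%E.
Proof.
move=> y0pi.
have shrink u : K u -> K ((2 / 3) *: u).
  move=> Ku; have := @KC (2 / 3) 0 u u Ku Ku; rewrite scale0r addr0; apply.
  by rewrite normr0 addr0 ger0_norm; lra.
apply: (@arc_growth_overlap _ [set x | K (circ p q x)]
  [set x | K ((2 / 3)%R *: circ p q x)]) => //.
- exact: closed_circ.
- rewrite (_ : [set x | _] = [set x | K (circ ((2 / 3) *: p) ((2 / 3) *: q) x)]).
    by apply: closed_measurable; exact: closed_circ.
  by apply/seteqP; split => x /=; rewrite circ_scale.
- by move=> x /=; rewrite circDpi; split => /KN; rewrite ?opprK.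
- by move=> x /=; rewrite circDpi scalerN; split => /KN; rewrite ?opprK.
- by move=> x /=; exact: shrink.
- by move=> a b x /=; exact: circ_extension.
- by move=> a b x /=; exact: circ_extension_left.
Qed.

End body.

Section haar_arc.
Variables (n : nat) (nu : probability 'M[R]_n R).

(** Tonelli: the mean length of a random set of angles is the integral over the half circle of the
    probability [c] that a given angle belongs to it. *)
Lemma haar_arc (C : 'M[R]_n -> R -> Prop) c :
    measurable [set p : 'M[R]_n * measurableTypeR R | C p.1 p.2] ->
    (forall x, nu [set U | C U x] = c) ->
  (\int[nu]_U mu ([set x | C U x] `&` `[0%R, pi[) = c * pi%:E)%E.
Proof.
move=> mC Cc; pose D U (x : measurableTypeR R) := C U x /\ `[0%R, pi[%classic x.
have mD : measurable [set p : 'M[R]_n * measurableTypeR R | D p.1 p.2].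
  apply: measurableI => //.
  by apply: (measurable_set_comp measurable_snd); exact: measurable_itv.
have c0 : (0 <= c)%E by rewrite -(Cc 0) measure_ge0.
transitivity (\int[mu]_x nu [set U | D U x])%E.
  by rewrite -(fubini_sections nu mu mD).
transitivity (\int[mu]_x (c * (\1_`[0%R, pi[ x)%:E))%E.
  apply: eq_integral => x _; rewrite indicE /D.
  have [xI|xI] := pselect (`[0%R, pi[%classic x).
    rewrite mem_set// mule1 -(Cc x); congr (nu _).
    by apply/seteqP; split => U // [].
  rewrite memNset// mule0 (_ : [set U | _] = set0) ?measure0//.
  by apply/seteqP; split => U // [].
rewrite ge0_integralZl//; last exact/measurable_EFinP/measurable_indic.
rewrite integral_indic// setIT; congr (c * _)%E.
have piE : mu `[0%R, pi[ = pi%:E.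
  by rewrite lebesgue_measure_itv/= lte_fin pi_gt0 sube0.
exact: piE.
Qed.

Lemma measurable_haar_arc (C : 'M[R]_n -> R -> Prop) :
    measurable [set p : 'M[R]_n * measurableTypeR R | C p.1 p.2] ->
  measurable_fun setT (fun U => mu ([set x | C U x] `&` `[0%R, pi[)).
Proof.
move=> mC; pose D U (x : measurableTypeR R) := C U x /\ `[0%R, pi[%classic x.
apply: (measurable_fun_section mu (A := D)).
apply: measurableI => //.
by apply: (measurable_set_comp measurable_snd); exact: measurable_itv.
Qed.

End haar_arc.

End plane_section.

(** * Averaging the planar comparison over random planes *)

Section haar_growth.
Context (R : realType) (n : nat).
Notation mu := (@lebesgue_measure R).
Let G (x : R) := givens n (cos x) (sin x).
Let e0 := cV0 R n.+1.
(** The second basis vector, as the image of the first by a quarter turn. *)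
Let e1 := G (pi / 2) *m e0.

Let orthogonal_G x : orthogonal_group n.+2 (G x).
Proof. exact: orthogonal_givens (cos2Dsin2 x). Qed.

Let circE x : circ e0 e1 x = G x *m e0.
Proof.
rewrite /circ /e1 /G !givens_cV0 /e0 cV0_cons -(cons_cV00 R n) !cons_cVZ !cons_cVD.
by rewrite cos_pihalf sin_pihalf !scaler0 !mulr0 !mulr1 addr0 add0r addr0.
Qed.

Let GD x y : G (x + y) *m e0 = G x *m (G y *m e0).
Proof.
rewrite /G !givens_cV0 givens_cons /rot /= cosD sinD.
by congr (cons_cV (_, cons_cV (_, _))); rewrite addrC.
Qed.

(** The angle [y] is the one between [e0] and [W *m e0], and [Q] turns the remaining coordinates so
    that the plane of the first two contains [W *m e0]. *)
Lemma orthogonal_plane (W : 'M[R]_n.+2) : orthogonal_group n.+2 W ->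
  exists Q y, [/\ orthogonal_group n.+2 Q, Q *m e0 = e0, 0 <= y <= pi &
    W *m e0 = Q *m (G y *m e0)].
Proof.
move=> oW; have [a [w We0]] := cV_consP (W *m e0).
have aw1 : a ^+ 2 + norm2 w ^+ 2 = 1.
  rewrite -sqr_norm2_col_mx -[RHS](expr1n _ 2) -(norm2_cV0 R n.+1).
  by rewrite -(norm2_orthogonal e0 oW) We0 cons_cVE.
have [V oV Vw] : exists2 V, orthogonal_group n.+1 V & V *m (norm2 w *: cV0 R n) = w.
  apply: orthogonal_transitive.
  by rewrite norm2Z norm2_cV0 mulr1 ger0_norm// norm2_ge0.
have a1 : -1 <= a <= 1.
  have w2 := sqr_ge0 (norm2 w).
  by apply/andP; split; nra.
exists (lift_mx V), (acos a); split.
- exact: orthogonal_lift_mx.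
- by rewrite /e0 cV0_cons lift_mx_cons mulmx0.
- by rewrite acos_ge0// acos_lepi.
rewrite /G acosK ?in_itv// sin_acos// givens_cV0 lift_mx_cons We0.
have -> : Num.sqrt (1 - a ^+ 2) = norm2 w.
  have -> : 1 - a ^+ 2 = norm2 w ^+ 2 by lra.
  by rewrite sqrtr_sqr ger0_norm// norm2_ge0.
by rewrite cons_cV0r Vw.
Qed.

Variable (nu : probability 'M[R]_n.+2 R) (hnu : is_haar_orthogonal nu).
Variable (K : set 'cV[R]_n.+2).
Hypothesis cK : closed K.
Hypothesis KC : forall a b u v, K u -> K v -> `|a| + `|b| <= 1 ->
  K (a *: u + b *: v).

Let mK : measurable K. Proof. exact: closed_mx_measurable. Qed.

Let measurable_circ_pair (p q : 'cV[R]_n.+2) :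
  measurable_fun setT (fun z : 'M[R]_n.+2 * measurableTypeR R =>
    circ (z.1 *m p) (z.1 *m q) z.2).
Proof.
have mU (v : 'cV[R]_n.+2) : measurable_fun setT
    (fun z : 'M[R]_n.+2 * measurableTypeR R => z.1 *m v).
  by apply: measurable_mulmx => //; exact: measurable_cst.
apply: measurable_addmx; apply: measurable_scalemx => //.
  apply: (measurableT_comp _ measurable_snd).
  by apply: continuous_measurable_fun; exact: continuous_cos.
apply: (measurableT_comp _ measurable_snd).
by apply: continuous_measurable_fun; exact: continuous_sin.
Qed.

(** The planar inequality is integrated over [U], for the circle in the plane of [U *m e0] and
    [U *m e1]. By right invariance each of the three probabilities is the same for all angles, and
    the common factor [pi] cancels. *)
Let growth_plane (r y : R) : 0 <= y <= pi ->
  ((3 / 2)%:E * nu [set U | K (U *m (r *: e0))] <=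
   nu [set U | K (U *m ((2 / 3 * r) *: e0))] +
   (1 / 2)%:E * nu [set U | K (U *m (r *: e0)) /\ K (U *m (r *: (G y *m e0)))])%E.
Proof.
move=> y0pi; set b := nu _; set b' := nu _; set f := nu _.
pose C1 (U : 'M[R]_n.+2) x := K (circ (U *m (r *: e0)) (U *m (r *: e1)) x).
pose C2 (U : 'M[R]_n.+2) x :=
  K ((2 / 3)%R *: circ (U *m (r *: e0)) (U *m (r *: e1)) x).
pose C3 U x := C1 U x /\ C1 U (x + y).
have UcircE U x : circ (U *m (r *: e0)) (U *m (r *: e1)) x = U *m (r *: (G x *m e0)).
  by rewrite -mulmx_circ circ_scale circE.
have mcirc := measurable_circ_pair (r *: e0) (r *: e1).
have mC1 : measurable [set p : 'M[R]_n.+2 * measurableTypeR R | C1 p.1 p.2].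
  exact: measurable_set_comp mcirc mK.
have mC2 : measurable [set p : 'M[R]_n.+2 * measurableTypeR R | C2 p.1 p.2].
  apply: measurable_set_comp mK; apply: measurable_scalemx => //.
have mC3 : measurable [set p : 'M[R]_n.+2 * measurableTypeR R | C3 p.1 p.2].
  apply: measurableI => //.
  pose s (p : 'M[R]_n.+2 * measurableTypeR R) : 'M[R]_n.+2 * measurableTypeR R :=
    (p.1, (p.2 + y : measurableTypeR R)).
  have ms : measurable_fun setT s.
    apply: measurable_fun_pair => //.
    exact: (measurableT_comp (measurable_addr y) measurable_snd).
  exact: (measurable_set_comp ms mC1).
have E1 x : nu [set U | C1 U x] = b.
  rewrite /b (haar_orbit hnu mK (y := r *: (G x *m e0))).
    by congr (nu _); apply/seteqP; split => U /=; rewrite /C1 UcircE.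
  by rewrite !norm2Z norm2_orthogonal.
have E2 x : nu [set U | C2 U x] = b'.
  rewrite /b' (haar_orbit hnu mK (y := (2 / 3 * r) *: (G x *m e0))).
    congr (nu _); apply/seteqP; split => U /=; rewrite /C2 UcircE;
      by rewrite -!scalemxAr scalerA.
  by rewrite !norm2Z norm2_orthogonal.
have E3 x : nu [set U | C3 U x] = f.
  pose D := [set U : 'M[R]_n.+2 | K (U *m (r *: e0)) /\ K (U *m (r *: (G y *m e0)))].
  have mD : measurable D by apply: measurableI; exact: measurable_orbit.
  rewrite /f -(haarR hnu (orthogonal_G x) mD); congr (nu _).
  apply/seteqP; split => U; rewrite /D/= /C3 /C1 !UcircE GD -!scalemxAr !mulmxA//.
have mu0 (A : set R) : (0 <= mu A)%E by exact: measure_ge0.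
have : ((3 / 2)%:E * (b * pi%:E) <= b' * pi%:E + (1 / 2)%:E * (f * pi%:E))%E.
  rewrite -(haar_arc mC1 E1) -(haar_arc mC2 E2) -(haar_arc mC3 E3).
  have m1 := measurable_haar_arc mC1; have m2 := measurable_haar_arc mC2.
  have m3 := measurable_haar_arc mC3.
  rewrite -ge0_integralZl// -[X in (_ <= _ + X)%E]ge0_integralZl//.
  rewrite -ge0_integralD//; last 2 first.
  - by move=> U _; exact: mule_ge0.
  - exact: measurable_funeM.
  apply: ge0_le_integral => //.
  - by move=> U _; exact: mule_ge0.
  - exact: measurable_funeM.
  - by apply: emeasurable_funD => //; exact: measurable_funeM.
  by move=> U _; exact: circ_growth.
have bfin : b \is a fin_num by exact: fin_num_measure (measurable_orbit mK _).
have b'fin : b' \is a fin_num by exact: fin_num_measure (measurable_orbit mK _).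
have ffin : f \is a fin_num.
  by apply: fin_num_measure; apply: measurableI; exact: measurable_orbit.
move: bfin b'fin ffin; case: b b' f {E1 E2 E3} => [b| |]// [b'| |]// [f| |]// _ _ _.
rewrite -!EFinM -!EFinD !lee_fin => H; rewrite -(@ler_pM2r _ pi) ?pi_gt0//.
by lra.
Qed.

(** For each orthogonal [W] the previous inequality applies with the angle between [e0] and
    [W *m e0]. Averaging over [W] makes the two events independent and replaces the overlap by a
    square. *)
Lemma haar_growth (r : R) :
  ((3 / 2)%:E * nu [set U | K (U *m (r *: e0))] <=
   nu [set U | K (U *m ((2 / 3 * r) *: e0))] +
   (1 / 2)%:E * (nu [set U | K (U *m (r *: e0))] * nu [set U | K (U *m (r *: e0))]))%E.
Proof.
have cO W : orthogonal_group n.+2 W ->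
  ((3 / 2)%:E * nu [set U | K (U *m (r *: e0))] <=
   nu [set U | K (U *m ((2 / 3 * r) *: e0))] +
   (1 / 2)%:E * nu [set U | K (U *m (r *: e0)) /\ K (U *m (W *m (r *: e0)))])%E.
  move=> /orthogonal_plane[Q [y [oQ Qe0 y0pi We0]]].
  apply: (le_trans (growth_plane r y0pi)).
  pose D := [set U : 'M[R]_n.+2 | K (U *m (r *: e0)) /\ K (U *m (r *: (G y *m e0)))].
  have mD : measurable D by apply: measurableI; exact: measurable_orbit.
  (* Since [Q] fixes [e0], right multiplication by [Q] changes the pair [e0], [G y *m e0] into [e0],
     [W *m e0]. *)
  rewrite leeD2l// -/D -(haarR hnu oQ mD); apply: lee_wpmul2l => //.
  rewrite le_eqVlt; apply/orP; left; apply/eqP; congr (nu _).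
  apply/seteqP; split => U; rewrite /D/= -!scalemxAr We0 -!mulmxA Qe0//.
rewrite -(haar_pair_orbit hnu mK (r *: e0)).
set b := nu [set U | K (U *m (r *: e0))]; set b' := nu _.
pose f W := nu [set U | K (U *m (r *: e0)) /\ K (U *m (W *m (r *: e0)))].
have mf : measurable_fun setT f.
  exact: (measurable_fun_section nu (measurable_pair_orbit mK (r *: e0))).
have f0 W : (0 <= f W)%E by exact: measure_ge0.
have b'0 : (0 <= b')%E by exact: measure_ge0.
have -> : (b' + (1 / 2)%:E * \int[nu]_W f W = \int[nu]_W (b' + (1 / 2)%:E * f W))%E.
  rewrite ge0_integralD//; last 2 first.
  - by move=> W _; exact: mule_ge0.
  - exact: measurable_funeM.
  by rewrite (integral_probability_cst nu) ge0_integralZl.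
rewrite -(integral_probability_cst nu ((3 / 2)%:E * b)).
apply: ae_ge0_le_integral => //.
- by move=> W _; rewrite mule_ge0// ?measure_ge0// lee_fin; lra.
- by move=> W _; rewrite adde_ge0// mule_ge0// lee_fin; lra.
- by apply: emeasurable_funD => //; exact: measurable_funeM.
exists (~` orthogonal_group n.+2); split.
- apply: measurableC; exact: measurable_orthogonal_group.
- exact: haar_setC.
by move=> W /= nW oW; apply: nW => _; exact: cO.
Qed.

End haar_growth.

(** * Symmetric convex bodies *)

Section convex_body.
Context (R : realType) (n : nat) (D : set 'cV[R]_n).
Hypothesis hD : symmetric_convex_body D.

Lemma body_opp u : D u -> D (- u).
Proof. by case: hD => _ _ _ DN Du; rewrite DN; exists u. Qed.

Lemma body_conv a u v : 0 <= a <= 1 -> D u -> D v -> D (a *: u + (1 - a) *: v).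
Proof.
case: hD => _ cD _ _ /andP[a0 a1] Du Dv.
have i01 : Itv.spec (@Itv.num_sem R) (Itv.Real `[0%Z, 1%Z]) a.
  by rewrite /Itv.num_sem/= in_itv/= num_real a0 a1.
have := cD u v (Itv.mk i01); rewrite !inE; exact.
Qed.

Lemma body0 : D 0.
Proof.
have [x /interior_subset Dx] : D° !=set0 by case: hD.
have := @body_conv (1 / 2) x (- x) _ Dx (body_opp Dx).
rewrite scalerN (_ : 1 - 1 / 2 = 1 / 2); last by lra.
by rewrite subrr; apply; lra.
Qed.

Lemma body_star a u : 0 <= a <= 1 -> D u -> D (a *: u).
Proof. by move=> a01 Du; have := body_conv a01 Du body0; rewrite scaler0 addr0. Qed.

(** Signs are absorbed by symmetry; what remains is a convex combination scaled by
    [|a| + |b| <= 1]. *)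
Lemma body_abs_conv a b u v : D u -> D v -> `|a| + `|b| <= 1 -> D (a *: u + b *: v).
Proof.
have sgn c w : D w -> exists2 w', D w' & c *: w = `|c| *: w'.
  move=> Dw; have [c0|c0] := leP 0 c; first by exists w; rewrite ?ger0_norm.
  by exists (- w); [exact: body_opp|rewrite ltr0_norm// scalerN scaleNr opprK].
move=> /(sgn a)[u' Du' ->] /(sgn b)[v' Dv' ->] ab1.
have [ab0|ab0] := eqVneq (`|a| + `|b|) 0.
  have -> : `|a| = 0 by apply/eqP; rewrite eq_le normr_ge0 andbT -ab0 lerDl.
  have -> : `|b| = 0 by apply/eqP; rewrite eq_le normr_ge0 andbT -ab0 lerDr.
  by rewrite !scale0r addr0; exact: body0.
have s0 : 0 < `|a| + `|b| by rewrite lt_def ab0 addr_ge0.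
have -> : `|a| *: u' + `|b| *: v' = (`|a| + `|b|) *:
    ((`|a| / (`|a| + `|b|)) *: u' + (1 - `|a| / (`|a| + `|b|)) *: v').
  rewrite scalerDr !scalerA mulrBr mulr1 !(mulrCA _ `|a|) divff// mulr1.
  by rewrite [in X in _ = _ + X]addrAC subrr add0r.
apply: body_star; first by rewrite ltW.
apply: body_conv => //; rewrite divr_ge0 ?(ltW s0)//=.
by rewrite ler_pdivrMr// mul1r lerDl.
Qed.

Lemma dilateE r y : r != 0 -> dilate r D y <-> D (r^-1 *: y).
Proof.
move=> r0; split => [[z Dz <-]|Dy]; first by rewrite scalerA mulVf// scale1r.
by exists (r^-1 *: y) => //; rewrite scalerA divff// scale1r.
Qed.

(** For an interior point [x], the body contains [x + (e / 2) *: y] for some [e > 0]; its midpoint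
    with [- x] is [(e / 4) *: y]. Hence the infimum defining the norm is over a nonempty set. *)
Lemma body_absorbing y : exists2 r, 0 < r & dilate r D y.
Proof.
have [x Dx] : D° !=set0 by case: hD.
have : x + k *: y @[k --> (0 : R)] --> x + 0 *: y.
  by apply: cvgD; [exact: cvg_cst|apply: cvgZr_tmp; exact: cvg_id].
rewrite scale0r addr0 => cx.
have /nbhs_ballP[e /= e0 eD] := cx _ Dx.
have De : D (x + (e / 2) *: y).
  apply: eD; rewrite /ball/= sub0r normrN gtr0_norm ?divr_gt0//.
  by rewrite ltr_pdivrMr// mulr2n mulrDr mulr1 ltrDl.
exists (4 / e); first by rewrite divr_gt0.
apply/dilateE; first by rewrite gt_eqF// divr_gt0.
have := @body_conv (1 / 2) _ _ _ De (body_opp (interior_subset Dx)).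
have -> : (1 / 2) *: (x + (e / 2) *: y) + (1 - 1 / 2) *: - x = (4 / e)^-1 *: y.
  rewrite (_ : 1 - 1 / 2 = 1 / 2); last by lra.
  rewrite -scalerDr addrAC subrr add0r scalerA; congr (_ *: y).
  by field; rewrite gt_eqF.
by apply; lra.
Qed.

(** A smaller dilate containing [y] would be included in the dilate by [r], as the body is
    star-shaped. *)
Lemma body_norm_ge r y : 0 < r -> ~ dilate r D y -> r <= body_norm D y.
Proof.
move=> r0 nD; apply: lb_le_inf => [|s [s0 Dsy]].
  by have [s s0 Ds] := body_absorbing y; exists s.
rewrite leNgt; apply/negP => sr; apply: nD.
apply/dilateE; first by rewrite gt_eqF.
move/dilateE : Dsy; rewrite gt_eqF// => /(_ isT) Dsy.
have -> : r^-1 *: y = (s / r) *: (s^-1 *: y).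
  by rewrite scalerA mulrAC divff ?gt_eqF// mul1r.
apply: body_star => //.
by rewrite divr_ge0 ?ltW//= ltr_pdivrMr// mul1r.
Qed.

Lemma body_norm_ge0 y : 0 <= body_norm D y.
Proof.
apply: lb_le_inf => [|s [/ltW s0 _]//].
by have [s s0 Ds] := body_absorbing y; exists s.
Qed.

Lemma dilate_star r a u : r != 0 -> 0 <= a <= 1 -> dilate r D u -> dilate r D (a *: u).
Proof.
move=> r0 a01 /(dilateE _ r0) Du; apply/(dilateE _ r0).
by rewrite scalerA mulrC -scalerA; exact: body_star.
Qed.

Lemma dilate_abs_conv r a b u v : r != 0 ->
  dilate r D u -> dilate r D v -> `|a| + `|b| <= 1 -> dilate r D (a *: u + b *: v).
Proof.
move=> r0 /(dilateE _ r0) Du /(dilateE _ r0) Dv ab1; apply/(dilateE _ r0).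
by rewrite scalerDr !scalerA !(mulrC r^-1) -!scalerA; exact: body_abs_conv.
Qed.

Lemma closed_body : closed D.
Proof. by apply: compact_closed; [exact: norm_hausdorff|case: hD]. Qed.

Lemma measurable_dilate r : r != 0 -> measurable (dilate r D).
Proof.
move=> r0; have -> : dilate r D = [set y | D (r^-1 *: y)].
  by apply/seteqP; split => y /(dilateE _ r0).
apply: (measurable_set_comp _ (closed_mx_measurable closed_body)).
by apply: measurable_scalemx => //; exact: measurable_cst.
Qed.

End convex_body.

(** * Bounding the proportion of a sphere in a star-shaped set by its Gaussian measure *)

Section sphere_bound.
Context (R : realType).

Lemma closed_dilate n (D : set 'cV[R]_n.+1) r :
  symmetric_convex_body D -> r != 0 -> closed (dilate r D).
Proof.
move=> hD r0; have -> : dilate r D = [set y | D (r^-1 *: y)].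
  by apply/seteqP; split => y /(dilateE _ _ r0).
apply: (closed_comp (f := fun y : 'cV[R]_n.+1 => r^-1 *: y)); last exact: closed_body.
by move=> y _; exact: scaler_continuous.
Qed.

Variables (n : nat) (nu : probability 'M[R]_n.+1 R).
Hypothesis hnu : is_haar_orthogonal nu.
Variable (K : set 'cV[R]_n.+1).
Hypothesis mK : measurable K.
Hypothesis starK : forall a u, 0 <= a <= 1 -> K u -> K (a *: u).
Let N : R := n.+1%:R.
Let e0 := cV0 R n.

Let N0 : 0 < N. Proof. by rewrite ltr0n. Qed.

(* The second moment is tested against the radial profile of [nu{U | U x \in K}]
   through the line [c (1 - |x|^2 / 4 n)]. *)
Lemma gaussian_ge_of_profile (c : R) : 0 <= c ->
    (forall x : 'cV[R]_n.+1,
      (c%:E <= nu [set U | K (U *m x)] + (c / (4 * N) * norm2 x ^+ 2)%:E)%E) ->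
  ((3 / 4 * c)%:E <= gaussian n.+1 K)%E.
Proof.
move=> c0 H; have k0 : 0 <= c / (4 * N) by rewrite divr_ge0// mulr_ge0 ?ltW.
have mn : measurable_fun setT (fun x : 'cV[R]_n.+1 => (norm2 x ^+ 2)%:E).
  apply/measurable_EFinP; under eq_fun do rewrite sqr_norm2.
  apply: measurable_sum => i; apply: measurable_funX; exact: measurable_mx_coord.
have mo : measurable_fun setT (fun x => nu [set U | K (U *m x)]).
  apply: (measurable_fun_section nu (A := fun x U => K (U *m x))).
  by apply: measurable_set_comp mK; exact: measurable_mulmx.
have sq0 (x : 'cV[R]_n.+1) : (0 <= (norm2 x ^+ 2)%:E)%E by rewrite lee_fin sqr_ge0.
have o0 (x : 'cV[R]_n.+1) : (0 <= nu [set U | K (U *m x)])%E by exact: measure_ge0.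
(* The hypothesis is integrated over [x]; as the second moment is at most [N], the quadratic term
   contributes at most [c / 4]. *)
have : (c%:E <= gaussian n.+1 K + (c / 4)%:E)%E.
  rewrite (gaussian_haar hnu mK) -(integral_probability_cst (gaussian n.+1) c%:E).
  apply: (@le_trans _ _ (\int[gaussian n.+1]_x (nu [set U | K (U *m x)] +
      (c / (4 * N))%:E * (norm2 x ^+ 2)%:E))%E).
    apply: ge0_le_integral => //.
    - by apply: emeasurable_funD => //; exact: measurable_funeM.
  rewrite ge0_integralD//; last 2 first.
  - by move=> x _; rewrite mule_ge0.
  - exact: measurable_funeM.
  apply: leeD => //; rewrite ge0_integralZl//.
  have -> : (c / 4)%:E = ((c / (4 * N))%:E * N%:E)%E.
    by rewrite -EFinM; congr EFin; field; rewrite gt_eqF.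
  by apply: lee_wpmul2l => //; exact: gaussian_second_moment.
have fg : gaussian n.+1 K \is a fin_num by exact: fin_num_measure.
by rewrite -(fineK fg) -EFinD !lee_fin; lra.
Qed.

Lemma norm2Z_cV0 r : 0 <= r -> norm2 (r *: e0) = r.
Proof. by move=> r0; rewrite norm2Z norm2_cV0 mulr1 ger0_norm. Qed.

(** The radius at which [c / (4 * N) * r0 ^+ 2] equals [c]: beyond it the quadratic term alone
    dominates [c]. *)
Let r0 : R := 2 * Num.sqrt N.

Let r0_ge0 : 0 <= r0. Proof. by rewrite mulr_ge0// sqrtr_ge0. Qed.

Let sqr_r0 : r0 ^+ 2 = 4 * N.
Proof. by rewrite exprMn sqr_sqrtr ?ltW//; ring. Qed.

Let orbit_ge r (x : 'cV[R]_n.+1) : 0 <= r -> norm2 x <= r ->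
  (nu [set U | K (U *m (r *: e0))] <= nu [set U | K (U *m x)])%E.
Proof. by move=> r_ge0 xr; apply: haar_orbit_le => //; rewrite norm2Z_cV0. Qed.

Let tail_ge (c : R) (x : 'cV[R]_n.+1) : 0 <= c -> r0 <= norm2 x ->
  c <= c / (4 * N) * norm2 x ^+ 2.
Proof.
move=> c0 rx; rewrite -mulrA ler_peMr// mulrC ler_pdivlMr ?mul1r ?mulr_gt0//.
by rewrite -sqr_r0 lerXn2r ?nnegrE ?norm2_ge0.
Qed.

(** The profile is tested with [c = b]: up to radius [r0] it is at least [b], and beyond it the
    quadratic term takes over. *)
Lemma sphere_bound_weak (b : R) : nu [set U | K (U *m (r0 *: e0))] = b%:E ->
  ((3 / 4 * b)%:E <= gaussian n.+1 K)%E.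
Proof.
move=> bE; have b0 : 0 <= b by rewrite -lee_fin -bE measure_ge0.
apply: gaussian_ge_of_profile => // x; have [xr|/ltW xr] := leP (norm2 x) r0.
  apply: (@le_trans _ _ (nu [set U | K (U *m x)])); first by rewrite -bE; exact: orbit_ge.
  by rewrite leeDl// lee_fin mulr_ge0 ?sqr_ge0// divr_ge0// mulr_ge0// ltW.
apply: (@le_trans _ _ (b / (4 * N) * norm2 x ^+ 2)%:E).
  by rewrite lee_fin; exact: tail_ge.
by rewrite leeDr.
Qed.

Lemma sphere_bound_growth (b b' : R) :
    nu [set U | K (U *m (r0 *: e0))] = b%:E ->
    nu [set U | K (U *m ((2 / 3 * r0) *: e0))] = b'%:E ->
    3 / 2 * b <= b' + 1 / 2 * (b * b) -> b <= 1 / 3 ->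
  (b%:E <= gaussian n.+1 K)%E.
Proof.
move=> bE b'E growth b13; have b0 : 0 <= b by rewrite -lee_fin -bE measure_ge0.
(* By the growth hypothesis, [c] is a lower bound for [b']. *)
pose c := 3 / 2 * b - 1 / 2 * (b * b).
have c0 : 0 <= c by rewrite /c; nra.
have cN0 : 0 <= c / (4 * N) by rewrite divr_ge0// mulr_ge0// ltW.
(* Here [b <= 1 / 3] enters: [3 / 4 * c - b = b (1 - 3 b) / 8]. *)
apply: (@le_trans _ _ (3 / 4 * c)%:E); first by rewrite lee_fin /c; nra.
apply: gaussian_ge_of_profile => // x.
have [xr|xr] := leP (norm2 x) (2 / 3 * r0).
  apply: (@le_trans _ _ (nu [set U | K (U *m x)])).
    apply: (@le_trans _ _ b'%:E); first by rewrite lee_fin /c; lra.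
    by rewrite -b'E; apply: orbit_ge => //; rewrite mulr_ge0.
  by rewrite leeDl// lee_fin mulr_ge0 ?sqr_ge0.
have [xr'|/ltW xr'] := leP (norm2 x) r0; last first.
  apply: (@le_trans _ _ (c / (4 * N) * norm2 x ^+ 2)%:E).
    by rewrite lee_fin; exact: tail_ge.
  by rewrite leeDr.
(* Between the two radii the profile is at least [b] and the quadratic term at least [(2 / 3)^2 c];
   their sum reaches [c] because [c <= 3 / 2 * b]. *)
apply: (@le_trans _ _ (b + c * (4 / 9))%:E).
  by rewrite lee_fin /c; nra.
rewrite EFinD leeD//; first by rewrite -bE; exact: orbit_ge.
rewrite lee_fin -mulrA ler_wpM2l// [leRHS]mulrC ler_pdivlMr ?mulr_gt0//.
rewrite -sqr_r0 (_ : 4 / 9 * r0 ^+ 2 = (2 / 3 * r0) ^+ 2); last by field.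
by rewrite lerXn2r ?nnegrE ?norm2_ge0 ?mulr_ge0// ltW.
Qed.

End sphere_bound.

(** * The sphere bound for dilates of a convex body of small Gaussian measure *)

Section haar_body_bound.
Variables (R : realType) (r : R).
Hypothesis r_neq0 : r != 0.

(** On the line the orthogonal group is [{1, -1}] and the dilate is symmetric, so the proportion is
    0 or 1; the weak bound [3 / 4 * b <= 1 / 2] excludes 1. *)
Let haar_body_bound_line (D : set 'cV[R]_1) (nu : probability 'M[R]_1 R) :
    is_haar_orthogonal nu -> symmetric_convex_body D ->
    (gaussian 1 (dilate r D) <= (2 ^- 1)%:E)%E ->
  (nu [set U | dilate r D (U *m ((2 * Num.sqrt 1%:R) *: cV0 R 0))] <=
   gaussian 1 (dilate r D))%E.
Proof.
move=> hnu hD small.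
have mK : measurable (dilate r D) by exact: measurable_dilate.
have starK := dilate_star hD r_neq0.
set K := dilate r D in small mK starK *.
set x := _ *: _; pose b := fine (nu [set U | K (U *m x)]).
have bE : nu [set U | K (U *m x)] = b%:E.
  by rewrite fineK//; exact: fin_num_measure (measurable_orbit mK x).
have := sphere_bound_weak hnu mK (fun a u => @starK a u) bE => /le_trans/(_ small).
rewrite lee_fin => weak.
have [[U [oU KU]]|none] := pselect (exists U, orthogonal_group 1 U /\ K (U *m x)).
  suff : b%:E = 1%E by case=> b1; exfalso; move: weak; rewrite b1 expr1; lra.
  rewrite -bE; apply/eqP; rewrite eq_le; apply/andP; split.
    by apply: probability_le1; exact: measurable_orbit.
  apply: (@le_trans _ _ (nu (orthogonal_group 1))); first by rewrite hnu.1.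
  apply: le_measure; rewrite ?inE;
    [exact: measurable_orthogonal_group|exact: measurable_orbit|].
  have sq1 (V : 'M[R]_1) : orthogonal_group 1 V -> V = 1%:M \/ V = - 1%:M.
    have [a ->] : exists a, V = a%:M.
      by exists (V ord0 ord0); apply/matrixP => i j; rewrite !ord1 mxE.
    rewrite /orthogonal_group/= tr_scalar_mx -scalar_mxM => /matrixP/(_ ord0 ord0).
    rewrite !mxE/= => aa; have : a ^+ 2 == 1 ^+ 2.
      by apply/eqP; rewrite expr1n expr2; exact: aa.
    rewrite eqf_sqr => /orP[/eqP->|/eqP->]; first by left.
    by right; rewrite raddfN.
  have KN y : K y -> K (- y).
    move=> Ky; have := dilate_abs_conv hD (a := -1) (b := 0) r_neq0 Ky Ky.
    by rewrite scaleN1r scale0r addr0 normrN1 normr0 addr0; apply.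
  have K1 : K x.
    case: (sq1 U oU) KU => ->; rewrite ?mulNmx mul1mx// => /KN.
    by rewrite opprK.
  move=> V /sq1[|] ->/=; rewrite ?mulNmx mul1mx//; exact: KN.
rewrite (_ : nu _ = 0%E) ?measure_ge0//; apply/eqP.
rewrite eq_le measure_ge0 andbT -(haar_setC hnu).
apply: le_measure; rewrite ?inE; [exact: measurable_orbit| |].
- by apply: measurableC; exact: measurable_orthogonal_group.
- by move=> U KU oU; apply: none; exists U.
Qed.

Let haar_body_bound_plane n (D : set 'cV[R]_n.+2) (nu : probability 'M[R]_n.+2 R) :
    is_haar_orthogonal nu -> symmetric_convex_body D ->
    (gaussian n.+2 (dilate r D) <= (2 ^- n.+2)%:E)%E ->
  (nu [set U | dilate r D (U *m ((2 * Num.sqrt n.+2%:R) *: cV0 R n.+1))] <=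
   gaussian n.+2 (dilate r D))%E.
Proof.
move=> hnu hD small.
have mK : measurable (dilate r D) by exact: measurable_dilate.
have starK := dilate_star hD r_neq0.
set K := dilate r D in small mK starK *.
set x := _ *: _; pose b := fine (nu [set U | K (U *m x)]).
have bE : nu [set U | K (U *m x)] = b%:E.
  by rewrite fineK//; exact: fin_num_measure (measurable_orbit mK x).
have := sphere_bound_weak hnu mK (fun a u => @starK a u) bE => /le_trans/(_ small).
rewrite lee_fin => weak.
set x' := (2 / 3 * (2 * Num.sqrt n.+2%:R)) *: cV0 R n.+1.
pose b' := fine (nu [set U | K (U *m x')]).
have b'E : nu [set U | K (U *m x')] = b'%:E.
  by rewrite fineK//; exact: fin_num_measure (measurable_orbit mK _).
rewrite bE; apply: (sphere_bound_growth hnu mK (fun a u => @starK a u) bE b'E).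
  have := haar_growth hnu (closed_dilate hD r_neq0)
    (fun a c u v => dilate_abs_conv hD r_neq0) (2 * Num.sqrt n.+2%:R).
  by rewrite -/x -/x' bE b'E -!EFinM -!EFinD lee_fin.
(* In dimension at least 2, the weak bound reads [3 / 4 * b <= 1 / 4], that is [b <= 1 / 3]. *)
have : (2 : R) ^- n.+2 <= 1 / 4.
  rewrite -exprVn !exprS; have p0 : 0 <= (2^-1 : R) ^+ n by rewrite exprn_ge0.
  have p1 : (2^-1 : R) ^+ n <= 1 by rewrite exprn_ile1//; lra.
  by lra.
by lra.
Qed.

Lemma haar_body_bound n (D : set 'cV[R]_n.+1) (nu : probability 'M[R]_n.+1 R) :
    is_haar_orthogonal nu -> symmetric_convex_body D ->
    (gaussian n.+1 (dilate r D) <= (2 ^- n.+1)%:E)%E ->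
  (nu [set U | dilate r D (U *m ((2 * Num.sqrt n.+1%:R) *: cV0 R n))] <=
   gaussian n.+1 (dilate r D))%E.
Proof.
case: n D nu => [|n] D nu; [exact: haar_body_bound_line|].
exact: haar_body_bound_plane.
Qed.

End haar_body_bound.

(** * The union bound over sign vectors and the conclusion *)

Lemma measure_bigsetU_le d (T : measurableType d) (R : realType)
    (P : {measure set T -> \bar R}) (I : eqType) (s : seq I) (F : I -> set T)
    (c : R) :
    (forall i, measurable (F i)) -> (forall i, i \in s -> (P (F i) <= c%:E)%E) ->
  (P (\big[setU/set0]_(i <- s) F i) <= ((size s)%:R * c)%:E)%E.
Proof.
move=> mF; elim: s => [|i s IHs] Fc; first by rewrite big_nil measure0 mul0r.
rewrite big_cons /= -nat1r mulrDl mul1r EFinD.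
apply: le_trans (measureU2 _ _ _) _ => //; first exact: bigsetU_measurable.
apply: leeD; first by apply: Fc; rewrite mem_head.
by apply: IHs => j js; apply: Fc; rewrite in_cons js orbT.
Qed.

Theorem theorem1p4 (R : realType) (n : nat) (hn : (0 < n)%N)
  (D : set 'cV[R]_n) (hD : symmetric_convex_body D)
  (delta : R) (hdelta : 0 < delta < 1)
  (m : R) (hm : is_median (gaussian n) (body_norm D) m)
  (t : R) (ht : is_maximum (t_set D delta m) t)
  (nu : probability 'M[R]_n R) (hnu : is_haar_orthogonal nu)
  (tau : R) (htau : 0 < tau)
  (x : 'I_n -> 'cV[R]_n)
  (hx : forall eps : {ffun 'I_n -> bool},
    tau * Num.sqrt n%:R <= norm2 (\sum_(i < n) sign eps i *: x i))
  (S : {set {ffun 'I_n -> bool}})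
  (hS : #|S|%:R <= 2 `^ (delta * n%:R)) :
  exists UU : set 'M[R]_n,
    [/\ UU `<=` orthogonal_group n,
        measurable UU,
        ((1 - expR (- n%:R))%:E <= nu UU)%E &
        forall U, UU U -> forall eps, eps \in S ->
          tau * t * m <= body_norm D (\sum_(i < n) sign eps i *: (U *m x i))].
Proof.
have [t0 tq] := ht.1.
(* For [m <= 0] the required lower bound is nonpositive and the whole orthogonal group works. *)
have [m0|m0] := leP m 0.
  exists (orthogonal_group n); split => //; first exact: measurable_orthogonal_group.
    by rewrite hnu.1 lee_fin gerBl expR_ge0.
  move=> U _ eps _; apply: le_trans (body_norm_ge0 hD _).
  by rewrite mulr_ge0_le0// mulr_ge0 ?ltW.
case: n hn D hD hm ht nu hnu x hx S hS tq => // n _ D hD _ _ nu hnu x hx S hS tq.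
pose s := tau * t * m; have s0 : 0 < s by rewrite !mulr_gt0.
have sn0 : s != 0 by rewrite gt_eqF.
pose v eps := \sum_(i < n.+1) sign eps i *: x i.
(* Every matrix [U] with [body_norm D (U *m v eps) < s] lies in [bad eps]. *)
pose bad eps := [set U : 'M[R]_n.+1 | dilate s D (U *m v eps)].
have mbad eps : measurable (bad eps).
  exact: measurable_orbit (measurable_dilate hD sn0) _.
pose e := 2 `^ delta * expR 1 : R.
(* As [e >= 2], the bound [e ^- n.+1] coming from [t] is below the threshold [2 ^- n.+1] of the
   sphere bound. *)
have e2 : 2 <= e.
  have e1 : 2 <= expR 1 :> R.
    by apply: le_trans (expR_ge1Dx 1); rewrite -[2]/(1 + 1)%:R natrD.
  have p1 : 1 <= 2 `^ delta :> R.
    rewrite -[leLHS](powRr0 2); apply: ler_powR; first by rewrite ler1n.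
    by case/andP: hdelta => /ltW.
  by rewrite -[leLHS]mul1r ler_pM.
have e0 : 0 < e by apply: lt_le_trans e2; rewrite ltr0n.
have small : (gaussian n.+1 (dilate (2 * t * m) D) <= (2 ^- n.+1)%:E)%E.
  apply: (le_trans tq); rewrite lee_fin lef_pV2 ?posrE ?exprn_gt0//.
  by rewrite lerXn2r// nnegrE ltW.
have r_neq0 : 2 * t * m != 0 by rewrite gt_eqF// !mulr_gt0.
have bad_le eps : (nu (bad eps) <= (e ^- n.+1)%:E)%E.
  apply: le_trans tq; apply: le_trans (haar_body_bound r_neq0 hnu hD small).
  have ts : 0 <= tau * Num.sqrt n.+1%:R by rewrite mulr_ge0 ?sqrtr_ge0// ltW.
  (* The signed sum has norm at least [tau sqrt n.+1], so its proportion is at most the one at that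
     radius. Rescaling by [tau / 2] then leads to the radius [2 sqrt n.+1] and the dilate by
     [2 * t * m]. *)
  apply: (@le_trans _ _ (nu [set U | dilate s D
      (U *m ((tau * Num.sqrt n.+1%:R) *: cV0 R n))])).
    apply: haar_orbit_le => //; first exact: measurable_dilate.
      by move=> a z; exact: dilate_star.
    by rewrite norm2Z_cV0//; exact: hx.
  rewrite le_eqVlt; apply/orP; left; apply/eqP; congr (nu _).
  have scE U : s^-1 *: (U *m ((tau * Num.sqrt n.+1%:R) *: cV0 R n)) =
      (2 * t * m)^-1 *: (U *m ((2 * Num.sqrt n.+1%:R) *: cV0 R n)).
    rewrite -!scalemxAr !scalerA; congr (_ *: _); rewrite /s; field.
    by rewrite !gt_eqF.
  apply/seteqP; split => U /=.
    by move=> /(dilateE _ _ sn0); rewrite scE => H; exact/dilateE.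
  by move=> /(dilateE _ _ r_neq0); rewrite -scE => H; exact/dilateE.
pose B := \big[setU/set0]_(eps <- enum S) bad eps.
have mB : measurable B by exact: bigsetU_measurable.
have nuB : (nu B <= (expR (- n.+1%:R))%:E)%E.
  apply: (@le_trans _ _ ((size (enum S))%:R * e ^- n.+1)%:E).
    by apply: measure_bigsetU_le => // eps _; exact: bad_le.
  rewrite lee_fin -cardE.
  (* The cardinality bound cancels the power of 2 in [e]: with [N = n.+1], [2 ^ (delta N) * (2 ^
     delta * expR 1) ^- N = expR (- N)]. *)
  rewrite ler_pdivrMr ?exprn_gt0// (le_trans hS)// /e exprMn.
  rewrite powRrM powR_mulrn ?powR_ge0// -expRM_natl mulr1 mulrCA -expRD.
  by rewrite addrC subrr expR0 mulr1.
exists (orthogonal_group n.+1 `\` B); split.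
- by move=> U [].
- by apply: measurableD => //; exact: measurable_orthogonal_group.
- have mO := @measurable_orthogonal_group R n.+1.
  have : (nu (orthogonal_group n.+1) <= nu (orthogonal_group n.+1 `\` B) + nu B)%E.
    rewrite (measureDI nu mO mB) leeD2l//; apply: le_measure; rewrite ?inE//.
    exact: measurableI.
  rewrite hnu.1 => H; rewrite EFinB leeBlDr//; apply: (le_trans H).
  by rewrite leeD2l.
move=> U [oU nBU] eps epsS.
have -> : \sum_(i < n.+1) sign eps i *: (U *m x i) = U *m v eps.
  by rewrite mulmx_sumr; apply: eq_bigr => i _; rewrite scalemxAr.
apply: body_norm_ge => // badU; apply: nBU; rewrite /B -bigcup_seq.
by exists eps => //=; rewrite mem_enum.
Qed.
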